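(* Let $p>1$. The Sadowsky functional $\mathcal{F}$ is sequentially weakly lower semicontinuous in $W^{3,p}(I;\mathbb{R}^3)$ at functions $\mathbf{u}\in X^p$ such that the set $\{t\in[0,1]:\mathbf{u}''(t)=0\}$ has measure zero.
   Context: $I=(0,1)$. Fix $\mathbf{A},\mathbf{B}\in\mathbb{R}^3\times\mathbb{S}^2$. Let $Y$ be the set of $\mathbf{u}\in C^\infty([0,1];\mathbb{R}^3)$ with $(\mathbf{u}(0),\mathbf{u}'(0))=\mathbf{A}$, $(\mathbf{u}(1),\mathbf{u}'(1))=\mathbf{B}$ and $|\mathbf{u}'(s)|=1$ for all $s\in I$; let $X^p$ be the closure of $Y$ in the norm of $W^{3,p}(I;\mathbb{R}^3)$. The Sadowsky functional is $$\mathcal{F}(\mathbf{u},I)=\int_I\kappa^2(1+\eta^2)^2\,ds,\qquad \kappa=|\mathbf{u}''|,\qquad \eta=\frac{\mathbf{u}'\cdot(\mathbf{u}''\times\mathbf{u}''')}{|\mathbf{u}''|^3}.$$ A functional $\mathcal{G}$ on a Banach space $\mathcal{B}$ is sequentially weakly lower semicontinuous in $\mathcal{B}$ at $\mathbf{x}\in\mathcal{B}$ if $\mathcal{G}(\mathbf{x})\le\liminf_{k\to\infty}\mathcal{G}(\mathbf{x}_k)$ for every sequence $\{\mathbf{x}_k\}$ in $\mathcal{B}$ that converges weakly in $\mathcal{B}$ to $\mathbf{x}$; here $\mathcal{B}=W^{3,p}(I;\mathbb{R}^3)$ and $\mathcal{G}=\mathcal{F}(\cdot,I)$. *)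

(* Defs.v *)
From HB Require Import structures.
From mathcomp Require Export all_boot all_order all_algebra.
From mathcomp Require Export all_classical all_reals all_analysis.

Set Implicit Arguments.
Unset Strict Implicit.
Unset Printing Implicit Defensive.
Import Order.TTheory GRing.Theory Num.Theory.
Import numFieldNormedType.Exports.
Local Open Scope classical_set_scope.
Local Open Scope ring_scope.

Section Vectors.
Context {R : realType}.
Implicit Types u v : 'rV[R]_3.

Definition dot u v : R := (u *m v^T) 0 0.

(* The norm [`|u|] of the library on row vectors is the sup norm, hence a
   separate Euclidean norm. *)
Definition enorm u : R := Num.sqrt (dot u u).

(* Indices are added modulo 3. *)
Definition cross u v : 'rV[R]_3 :=
  \row_(j < 3) (u 0 (j + 1) * v 0 (j + 2) - u 0 (j + 2) * v 0 (j + 1)).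

End Vectors.

Section Sobolev.
Context {R : realType}.
Local Notation mu := (@lebesgue_measure R).

Definition unit_itv : set R := `]0, 1[.

Definition smooth (V : normedModType R) (f : R -> V) :=
  forall (n : nat) (x : R), derivable (derive1n n f) x 1.

Definition test_function (phi : R -> R) :=
  let supp := closure [set x | phi x != 0] in
  [/\ smooth phi, compact supp & supp `<=` unit_itv].

(* A function on (0,1) is represented by any function on the whole line
   extending it; values outside (0,1) are irrelevant below. *)

Definition is_weak_derivative (n : nat) (u g : R -> 'rV[R]_3) :=
  forall j : 'I_3,
    locally_integrable unit_itv (fun x => g x 0 j) /\
    forall phi : R -> R, test_function phi ->
      \int[mu]_(x in unit_itv) (u x 0 j * derive1n n phi x) =
      (-1) ^+ n * \int[mu]_(x in unit_itv) (g x 0 j * phi x).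

(* Some representative of the n-th weak derivative, when there is one. Weak
   derivatives are unique up to null sets, and [wderiv] is only used below in
   expressions insensitive to null sets. *)
Definition wderiv (n : nat) (u : R -> 'rV[R]_3) : R -> 'rV[R]_3 :=
  xget (cst 0) [set g | is_weak_derivative n u g].

Definition in_Lp (p : R) (g : R -> 'rV[R]_3) :=
  forall j : 'I_3, (fun x => g x 0 j) \_ unit_itv \in Lfun mu p%:E.

Definition Lp_norm (p : R) (g : R -> 'rV[R]_3) : \bar R :=
  'N[mu]_p%:E [EFin \o ((fun x => enorm (g x)) \_ unit_itv)].

Definition sobolev (m : nat) (p : R) : set (R -> 'rV[R]_3) :=
  [set u | in_Lp p u /\ forall n, (0 < n <= m)%N ->
     exists g, in_Lp p g /\ is_weak_derivative n u g].

(* The usual variants of this norm are equivalent to it, so they give the same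
   closures and the same weak convergence. *)
Definition sobolev_norm (m : nat) (p : R) (u : R -> 'rV[R]_3) : \bar R :=
  (\sum_(n < m.+1) Lp_norm p (wderiv n u))%E.

End Sobolev.

(* Weak convergence and weak lower semicontinuity in the normed space given by
   a linear subspace [B] of [V] and a seminorm [N], finite on [B]: for Sobolev
   spaces, almost everywhere equal functions are at distance 0, so that bounded
   functionals are exactly those of the quotient. *)
Section WeakConvergence.
Context {R : realType} {V : lmodType R}.
Variables (B : set V) (N : V -> \bar R).

Definition bounded_functional (phi : V -> R) :=
  (forall (a : R) (x y : V), B x -> B y ->
     phi (a *: x + y) = a * phi x + phi y) /\
  exists C : R, forall x, B x -> (`|phi x|%:E <= C%:E * N x)%E.

Definition weakly_converges (x_ : nat -> V) (x : V) :=
  forall phi : V -> R, bounded_functional phi ->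
    phi (x_ n) @[n --> \oo] --> phi x.

Definition seq_weakly_lsc_at (G : V -> \bar R) (x : V) :=
  forall x_ : nat -> V, (forall k, B (x_ k)) -> weakly_converges x_ x ->
    (G x <= limn_einf (G \o x_))%E.

End WeakConvergence.

Section Sadowsky.
Context {R : realType}.
Local Notation mu := (@lebesgue_measure R).
Local Notation curve := (R -> 'rV[R]_3).

Definition curvature (u : curve) (s : R) : R := enorm (wderiv 2 u s).

(* Where the curvature vanishes, [x / 0 = 0] gives 0 and so does the integrand
   of [sadowsky]. *)
Definition torsion_ratio (u : curve) (s : R) : R :=
  dot (wderiv 1 u s) (cross (wderiv 2 u s) (wderiv 3 u s))
  / enorm (wderiv 2 u s) ^+ 3.

Definition sadowsky (u : curve) : \bar R :=
  (\int[mu]_(s in unit_itv)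
     (curvature u s ^+ 2 * (1 + torsion_ratio u s ^+ 2) ^+ 2)%:E)%E.

(* Elements of C^oo([0,1]) are represented by smooth extensions to the line. *)
Definition Y_ (A B : 'rV[R]_3 * 'rV[R]_3) : set curve :=
  [set u | [/\ smooth u, (u 0, derive1 u 0) = A, (u 1, derive1 u 1) = B &
              forall s, s \in unit_itv -> enorm (derive1 u s) = 1]].

Definition X_ (p : R) (A B : 'rV[R]_3 * 'rV[R]_3) : set curve :=
  [set u | sobolev 3 p u /\ forall e : R, 0 < e ->
     exists2 v, Y_ A B v & (sobolev_norm 3 p (u - v)%R < e%:E)%E].

End Sadowsky.

(* Main.v *)
Require Import Defs.
From mathcomp Require Import measurable_realfun ring lra.

(** Weak convergence [u_k -> u] in [W^{3,p}] gives weak convergence of the third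
    derivatives against bounded functions, hence, by uniform boundedness, an
    [L^1] bound on them. A weakly differentiable [f] satisfies, for almost every
    [t], [f t = \int f rho' - \int f' (H_t - rho)], with [H_t] the Heaviside
    function at [t] and [rho] a fixed smooth step; so point evaluation of the
    first two derivatives is a weakly continuous functional, and [u_k'], [u_k'']
    converge almost everywhere.

    With [kappa^2 eta = (u' x u'') . u''' / kappa], convexity of
    [x |-> (1 + x^2)^2] bounds the integrand for [u_k] from below by
    [kappa_k^2 (1 + eta^2)^2 + 4 eta (1 + eta^2) kappa_k^2 (eta_k - eta)], where
    [eta] belongs to the limit [u]. This bound is affine in [u_k'''], with
    coefficients converging wherever [u'' <> 0]. By Egorov the coefficients
    converge uniformly off sets of small measure, which, together with the
    [L^1] bound, allows passing to the limit there. *)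

Set Implicit Arguments.
Unset Strict Implicit.
Unset Printing Implicit Defensive.
Import Order.TTheory GRing.Theory Num.Theory.
Import numFieldNormedType.Exports.
Local Open Scope classical_set_scope.
Local Open Scope ring_scope.

(** * A smooth step function *)

(** Weak convergence tests [u_k'''] only against a function independent of [k], whereas the
    coefficients of the minorant move with [k]. The resulting error, [u_k'''] times the difference
    of the coefficients, is small only if an L^1 bound on the first factor meets a uniform bound on
    the second; this is why both uniform boundedness and Egorov enter.

    Taking the tangent at the [eta] of the limit makes the minorant exact at [u], but this [eta]
    contains [u'''] and is merely measurable, so the coefficients are unbounded. The argument is
    therefore run on the sets where all data of the limit are at most [m]. As the integrand is
    nonnegative, the rest of the interval may be discarded for [u_k], and it is recovered for [u] by
    monotone convergence in [m].

    Point evaluation by an integral formula replaces a compact embedding: it yields almost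
    everywhere convergence of the whole sequence, so no subsequence has to be related to the lower
    limit. *)

Section SmoothFunctions.
Context {R : realType}.
Implicit Types (f g : R -> R) (n m : nat).

(* Unlike [derive1n], this peels off the innermost derivative first, which lets
   the product and quotient rules be iterated by induction on [n]. *)
Fixpoint diffn n f : Prop :=
  if n is m.+1 then (forall x, derivable f x 1) /\ diffn m (derive1 f) else True.

Lemma smooth_diffn f : (forall n, diffn n f) -> smooth f.
Proof.
move=> + n; elim: n f => [|n IH] f fn x.
  by have [] := fn 1%N.
by rewrite derive1Sn; apply: IH => m; have [] := fn m.+1.
Qed.

Lemma diffnW n f : diffn n.+1 f -> diffn n f.
Proof. by elim: n f => //= n IH f [df dff]; split=> //; exact: IH. Qed.

Lemma diffn_cst n (c : R) : diffn n (cst c).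
Proof.
elim: n c => //= n IH c; split; first by move=> x; exact: derivable_cst.
have -> : derive1 (cst c) = cst (0 : R) by apply/funext => x; rewrite derive1_cst.
exact: IH.
Qed.

Lemma diffnD n f g : diffn n f -> diffn n g -> diffn n (fun x => f x + g x).
Proof.
elim: n f g => //= n IH f g [df dff] [dg dgg]; split.
  by move=> x; exact: derivableD.
have -> : derive1 (fun x => f x + g x) = (fun x => (derive1 f) x + (derive1 g) x).
  by apply/funext => x; rewrite !derive1E deriveD.
exact: IH.
Qed.

Lemma diffnM n f g : diffn n f -> diffn n g -> diffn n (fun x => f x * g x).
Proof.
elim: n f g => //= n IH f g df dg.
have := diffnW df; have := diffnW dg => dg' df'.
case: df dg => [df dff] [dg dgg]; split; first by move=> x; exact: derivableM.
have -> : derive1 (fun x => f x * g x) = (fun x => f x * (derive1 g) x + g x * (derive1 f) x).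
  by apply/funext => x; rewrite !derive1E deriveM.
by apply: diffnD; exact: IH.
Qed.

Lemma diffnV n f : (forall x, f x != 0) -> diffn n f -> diffn n (fun x => (f x)^-1).
Proof.
move=> f0; elim: n => //= n IH df.
have df' := diffnW df; have {}IH := IH df'.
case: df => [df dff]; split; first by move=> x; exact: derivableV.
have -> : derive1 (fun x => (f x)^-1) =
    (fun x => ((cst (-1) x) * ((f x)^-1 * (f x)^-1)) * (derive1 f) x).
  apply/funext => x; rewrite !derive1E deriveV//= /GRing.scale/= mulN1r.
  by rewrite expr2 invfM.
apply: diffnM => //; apply: diffnM; first exact: diffn_cst.
exact: diffnM.
Qed.

Lemma is_derive_affine f (a b x : R) : derivable f (a * x + b) 1 ->
  is_derive x 1 (fun x => f (a * x + b)) (a * (derive1 f) (a * x + b)).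
Proof.
move=> df.
have dg : is_derive x 1 (fun x => a * x + b) a.
  have -> : a = a *: 1 + 0 by rewrite addr0 /GRing.scale/= mulr1.
  have -> : (fun x0 => (a *: 1 + 0) * x0 + b) = (a *: id) + cst b :> (R -> R).
    by apply/funext => y /=; rewrite addr0 !fctE /GRing.scale/= mulr1.
  exact: is_deriveD.
have df' : is_derive (a * x + b) 1 f (derive1 f (a * x + b)).
  by apply: DeriveDef => //; rewrite derive1E.
apply: (@is_derive_eq _ _ _ _ _ _ _ _ (@is_derive1_comp R f (fun x => a * x + b) _ _ _ df' dg)).
by rewrite /GRing.scale/= mulrC.
Qed.

Lemma diffn_affine n f (a b : R) : diffn n f -> diffn n (fun x => f (a * x + b)).
Proof.
elim: n f => //= n IH f [df dff]; split.
  by move=> x; exact: (@ex_derive _ _ _ _ _ _ _ (is_derive_affine (df _))).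
have -> : derive1 (fun x => f (a * x + b)) = (fun x => cst a x * (derive1 f) (a * x + b)).
  apply/funext => x; rewrite derive1E.
  by rewrite (@derive_val _ _ _ _ _ _ _ (is_derive_affine (df _))).
by apply: diffnM; [exact: diffn_cst|exact: IH].
Qed.

(* [x^-n exp(-1/x)]: the family spans a space stable under differentiation. *)
Definition flat n (x : R) : R := if 0 < x then x^-1 ^+ n * expR (- x^-1) else 0.

Lemma flat_ge0 n x : 0 <= flat n x.
Proof.
rewrite /flat; case: ifPn => // x0.
by rewrite mulr_ge0// ?expR_ge0// exprn_ge0// invr_ge0 ltW.
Qed.

(** With [y = 1/x] and [N = n + 2], raising [1 + y/N <= exp (y/N)] to the power [N] gives
    [(y/N)^N <= exp y]. The exponent [n + 2] leaves a factor [x^2] after the [n] negative powers are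
    absorbed, which is what differentiability at 0 requires. *)
Lemma flat_le n x : flat n x <= n.+2%:R ^+ n.+2 * x ^+ 2.
Proof.
rewrite /flat; case: ifPn => x0; last by rewrite mulr_ge0// ?sqr_ge0// exprn_ge0.
have N0 : 0 < n.+2%:R :> R by [].
have xV0 : 0 < x^-1 by rewrite invr_gt0.
have y0 : 0 < x^-1 / n.+2%:R by rewrite divr_gt0.
have e : (x^-1 / n.+2%:R) ^+ n.+2 <= expR (x^-1).
  have -> : expR (x^-1) = expR (x^-1 / n.+2%:R) ^+ n.+2.
    by rewrite -expRM_natl mulrC divfK// gt_eqF.
  rewrite lerXn2r// ?nnegrE ?expR_ge0// ?ltW//.
  by rewrite (lt_le_trans _ (expR_ge1Dx _))// ltrDr.
have NN0 : 0 < n.+2%:R ^+ n.+2 :> R by apply: exprn_gt0.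
have xx0 : 0 < x^-1 ^+ n by apply: exprn_gt0.
have x20 : 0 < x ^+ 2 by apply: exprn_gt0.
rewrite expRN -ler_pdivlMl; last exact: xx0.
rewrite invf_ple ?posrE; [|exact: expR_gt0|].
  2: by apply: mulr_gt0; [rewrite invr_gt0|apply: mulr_gt0].
apply: le_trans e; rewrite le_eqVlt; apply/orP; left; apply/eqP.
have xn0 : x != 0 by rewrite gt_eqF.
have Nn0 : n.+2%:R ^+ n.+2 != 0 :> R by rewrite expf_neq0.
have xE : x ^+ n.+2 = x ^+ n * x ^+ 2 by rewrite -exprD addn2.
rewrite exprMn !exprVn xE; move: (_ ^+ n.+2) Nn0 => N' Nn0.
by field; rewrite ?xn0 ?expf_neq0 ?Nn0.
Qed.

(** Away from 0 this is the product rule. At 0 the formula gives 0, and [flat_le] bounds the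
    difference quotient by a multiple of [|h|]. *)
Lemma is_derive_flat n (x : R) :
  is_derive x 1 (flat n) (- n%:R * flat n.+1 x + flat n.+2 x).
Proof.
have [x0|x0|->] := ltgtP x 0.
- have E : {near x, cst 0 =1 flat n}.
    near=> y; rewrite /flat ifF//; apply/negbTE; rewrite -leNgt ltW//.
    by near: y; exact: lt_nbhsl.
  have -> : - n%:R * flat n.+1 x + flat n.+2 x = 0.
    by rewrite /flat !ifF ?mulr0 ?addr0//; apply/negbTE; rewrite -leNgt ltW.
  exact: (near_eq_is_derive E (is_derive_cst (0:R) _ _)).
- have E : {near x, (fun y => y^-1 ^+ n * expR (- y^-1)) =1 flat n}.
    by near=> y; rewrite /flat ifT//; near: y; exact: lt_nbhsr.
  apply: (near_eq_is_derive E).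
  have xn0 : x != 0 by rewrite gt_eqF.
  have dV : is_derive x 1 (fun y : R => y^-1) (- x ^- 2).
    have dI : is_derive x 1 (@id R) 1 by exact: is_derive_id.
    apply: (@is_derive_eq _ _ _ _ _ _ _ _ (is_deriveV xn0 dI)).
    by rewrite /GRing.scale/= mulr1.
  have dE : is_derive x 1 (fun y : R => expR (- y^-1)) (expR (- x^-1) * (x ^- 2)).
    apply: (@is_derive_eq _ _ _ _ _ _ _ _ (is_derive1_comp (is_derive_expR _) (is_deriveN dV))).
    by rewrite /GRing.scale/= opprK mulrC.
  have -> : (fun y => y^-1 ^+ n * expR (- y^-1)) =
      ((fun y : R => y^-1) ^+ n) * (fun y : R => expR (- y^-1)).
    by apply/funext => y; rewrite !fctE.
  apply: (@is_derive_eq _ _ _ _ _ _ _ _ (is_deriveM (is_deriveX n dV) dE)).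
  rewrite /GRing.scale/= /flat x0 !fctE.
  case: n E => [|n] E.
    by rewrite !expr0; field; rewrite xn0.
  by rewrite /= !exprS; field; rewrite xn0.
- have -> : - n%:R * flat n.+1 0 + flat n.+2 0 = 0.
    by rewrite /flat ltxx mulr0 addr0.
  suff c0 : (fun h : R => h^-1 *: (flat n (h *: 1 + 0) - flat n 0)) @ 0^' --> (0:R).
    by apply: DeriveDef; [apply/cvg_ex; exists 0 => //|exact: cvg_lim c0].
  pose C := n.+2%:R ^+ n.+2 : R.
  apply/cvgr0Pnorm_le => e e0; near=> h.
  have h0 : h != 0 by near: h; exact: nbhs_dnbhs_neq.
  have he : `|h| <= e / C.
    near: h; apply: dnbhs0_le; rewrite divr_gt0// exprn_gt0//.
  rewrite /GRing.scale/= mulr1 addr0 [flat n 0]/flat ltxx subr0 normrM normfV.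
  rewrite ler_pdivrMl ?normr_gt0// (ger0_norm (flat_ge0 _ _)).
  apply: (le_trans (flat_le _ _)).
  rewrite -real_normK ?num_real// expr2 mulrCA ler_wpM2l//.
  by rewrite -ler_pdivlMl ?exprn_gt0// mulrC.
Unshelve. all: by end_near. Qed.

Lemma diffn_flat m n : diffn m (flat n).
Proof.
elim: m n => //= m IH n; split; first by move=> x; have [] := is_derive_flat n x.
have -> : derive1 (flat n) = (fun x => cst (- n%:R) x * flat n.+1 x + flat n.+2 x).
  by apply/funext => x; rewrite derive1E; have [_ ->] := is_derive_flat n x.
by apply: diffnD => //; apply: diffnM => //; exact: diffn_cst.
Qed.

Lemma flat_gt0 n x : 0 < x -> 0 < flat n x.
Proof.
by move=> x0; rewrite /flat x0 mulr_gt0 ?expR_gt0// exprn_gt0// invr_gt0.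
Qed.

Lemma flat_eq0 n x : x <= 0 -> flat n x = 0.
Proof. by move=> x0; rewrite /flat ltNge x0. Qed.

(** The denominator never vanishes because [1 + x] and [1 - x] cannot both be nonpositive. The
    transition from 0 to 1 takes place on [-1, 1]. *)
Definition step (x : R) : R := flat 0 (1 + x) / (flat 0 (1 + x) + flat 0 (1 - x)).

Lemma step_den_gt0 x : 0 < flat 0 (1 + x) + flat 0 (1 - x).
Proof.
have [x0|x0] := leP 0 x.
  by rewrite ltr_wpDr ?flat_ge0// flat_gt0//; lra.
by rewrite ltr_wpDl ?flat_ge0// flat_gt0//; lra.
Qed.

Lemma step_ge0 x : 0 <= step x.
Proof. by rewrite divr_ge0 ?flat_ge0// ltW// step_den_gt0. Qed.

Lemma step_le1 x : step x <= 1.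
Proof. by rewrite ler_pdivrMr ?step_den_gt0// mul1r lerDl flat_ge0. Qed.

Lemma step0 x : x <= -1 -> step x = 0.
Proof. by move=> x1; rewrite /step (@flat_eq0 _ (1 + x)) ?mul0r//; lra. Qed.

Lemma step1 x : 1 <= x -> step x = 1.
Proof.
move=> x1; have := step_den_gt0 x; rewrite /step (@flat_eq0 _ (1 - x)); last by lra.
by rewrite addr0 => ?; rewrite divff// gt_eqF.
Qed.

Lemma diffn_step n : diffn n step.
Proof.
have D (a : R) : diffn n (fun x => flat 0 (a * x + 1)).
  exact: diffn_affine (diffn_flat _ _).
have E1 x : flat 0 (1 + x) = flat 0 (1 * x + 1) by congr flat; lra.
have E2 x : flat 0 (1 - x) = flat 0 (-1 * x + 1) by congr flat; lra.
have -> : step = fun x => flat 0 (1 * x + 1) * (flat 0 (1 * x + 1) + flat 0 (-1 * x + 1))^-1.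
  by apply/funext => x; rewrite /step E1 E2.
apply: diffnM => //; apply: diffnV; last exact: diffnD.
by move=> x; rewrite -E1 -E2 gt_eqF// step_den_gt0.
Qed.

End SmoothFunctions.

(** * Integration lemmas *)

Section Integrals.
Context d (T : measurableType d) (R : realType) (mu : {measure set T -> \bar R}).
Variables (D : set T) (mD : measurable D).

Lemma bounded_on (f : T -> R) (M : R) :
  (forall x, D x -> `|f x| <= M) -> [bounded f x | x in D].
Proof.
move=> fM; exists M; split=> [|y My x Dx]; first exact: num_real.
by rewrite /= (le_trans (fM _ Dx))// ltW.
Qed.

Lemma integrable_mulr_bounded (f g : T -> R) (M : R) :
  mu.-integrable D (EFin \o f) -> measurable_fun D g ->
  (forall x, D x -> `|g x| <= M) ->
  mu.-integrable D (EFin \o (fun x => f x * g x)).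
Proof.
move=> fi mg gM.
have -> : EFin \o (fun x => f x * g x) = ((EFin \o f) \* (EFin \o g))%E.
  by apply/funext => x /=; rewrite EFinM.
by apply: integrableMl => //; exact: bounded_on gM.
Qed.

Lemma normr_Rintegral_mulr_le (f g : T -> R) (M : R) :
  mu.-integrable D (EFin \o f) -> measurable_fun D g ->
  (forall x, D x -> `|g x| <= M) ->
  `|\int[mu]_(x in D) (f x * g x)| <= M * \int[mu]_(x in D) `|f x|.
Proof.
move=> fi mg gM; have fg := integrable_mulr_bounded fi mg gM.
rewrite (le_trans (le_normr_Rintegral mD fg))//.
have nf : mu.-integrable D (EFin \o (fun x => `|f x|)) by exact: integrable_norm.
rewrite -RintegralZl//; apply: le_Rintegral => //.
- exact: integrable_norm fg.
- rewrite (_ : EFin \o _ = (fun x => M%:E * (EFin \o (fun x => `|f x|%R)) x)%E)//.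
  exact: integrableZl.
- by move=> x Dx; rewrite normrM mulrC ler_wpM2r// gM.
Qed.

Lemma cvg_Rintegral_mulr_bounded (f : T -> R) (g_ : nat -> T -> R) (g : T -> R) (M : R) :
  mu.-integrable D (EFin \o f) -> (forall n, measurable_fun D (g_ n)) ->
  (forall n x, D x -> `|g_ n x| <= M) ->
  (forall x, D x -> g_ n x @[n --> \oo] --> g x) ->
  \int[mu]_(x in D) (f x * g_ n x) @[n --> \oo] --> \int[mu]_(x in D) (f x * g x).
Proof.
move=> fi mg gM gc.
have mf : measurable_fun D f by move/integrableP : fi => [/measurable_EFinP].
have mgl : measurable_fun D g by exact: measurable_fun_cvg mg gc.
have gl x : D x -> `|g x| <= M.
  move=> Dx; have h : `|g_ n x| @[n --> \oo] --> `|g x| by apply: cvg_norm; exact: gc.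
  rewrite -(cvg_lim _ h)//; apply: limr_le; first by apply/cvg_ex; eexists; exact: h.
  by apply: nearW => n; exact: gM.
have di : mu.-integrable D (fun x => (M%:E * (EFin \o (fun x => `|f x|%R)) x)%E).
  by apply: integrableZl => //; exact: integrable_norm.
have [|||||_ _ c] := @dominated_convergence _ _ _ mu D mD
  (fun n => EFin \o (fun x => f x * g_ n x)) (EFin \o (fun x => f x * g x))
  (fun x => (M%:E * (EFin \o (fun x => `|f x|%R)) x)%E).
- by move=> n; apply/measurable_EFinP; exact: measurable_funM.
- by apply/measurable_EFinP; exact: measurable_funM.
- apply: aeW => x Dx; apply: cvg_EFin; first exact: nearW.
  by apply: cvgMr; exact: gc.
- exact: di.
- apply: aeW => x n Dx /=; rewrite -EFinM lee_fin normrM mulrC ler_wpM2r//.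
  exact: gM.
- by apply: fine_cvg; rewrite /= fineK//; exact: integrable_fin_num
    (integrable_mulr_bounded fi mgl gl).
Qed.

Lemma aeS (P Q : T -> Prop) :
  (\forall x \ae mu, P x) -> (forall x, P x -> Q x) -> \forall x \ae mu, Q x.
Proof. by move=> aP PQ; apply: filterS aP. Qed.

Lemma aeI (P Q : T -> Prop) : (\forall x \ae mu, P x) -> (\forall x \ae mu, Q x) ->
  \forall x \ae mu, P x /\ Q x.
Proof. by move=> aP aQ; apply: filterS2 aP aQ. Qed.

Lemma ae_forall_finType (I : finType) (P : I -> T -> Prop) :
  (forall i, \forall x \ae mu, P i x) -> \forall x \ae mu, forall i, P i x.
Proof.
move=> aP.
have : \forall x \ae mu, forall i, i \in index_enum I -> P i x.
  elim: (index_enum I) => [|i s IH]; first exact: aeW.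
  apply: (aeS (aeI (aP i) IH)) => x [h1 h2] j.
  by rewrite in_cons => /predU1P[->|/h2].
by move=> h; apply: (aeS h) => x {}h i; apply: h; exact: mem_index_enum.
Qed.

Lemma ae_integrable (f g : T -> R) : measurable_fun D g ->
  (\forall x \ae mu, D x -> f x = g x) ->
  mu.-integrable D (EFin \o f) -> mu.-integrable D (EFin \o g).
Proof.
move=> mg fg /integrableP[/measurable_EFinP mf foo]; apply/integrableP; split.
  exact/measurable_EFinP.
rewrite (le_lt_trans _ foo)// le_eqVlt; apply/orP; left; apply/eqP.
apply: ge0_ae_eq_integral => //.
- by apply/measurable_EFinP; exact: measurableT_comp.
- by apply/measurable_EFinP; exact: measurableT_comp.
- by rewrite /ae_eq; apply: (aeS fg) => x h Dx /=; rewrite h.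
Qed.

Lemma ae_eq_Rintegral (f g : T -> R) : measurable_fun D f -> measurable_fun D g ->
  (\forall x \ae mu, D x -> f x = g x) ->
  \int[mu]_(x in D) f x = \int[mu]_(x in D) g x.
Proof.
move=> mf mg fg; congr fine; apply: ae_eq_integral => //.
- exact/measurable_EFinP.
- exact/measurable_EFinP.
- by rewrite /ae_eq; apply: (aeS fg) => x h Dx /=; rewrite h.
Qed.

End Integrals.

(** * Mollification at Lebesgue points *)

Section Mollification.
Context {R : realType}.
Local Notation mu := (@lebesgue_measure R).

Lemma measurable_unit_itv : @measurable _ (measurableTypeR R) (@unit_itv R).
Proof. exact: measurable_itv. Qed.

Lemma derivable_continuous (f : R -> R) : (forall x, derivable f x 1) -> continuous f.
Proof. by move=> df x; apply/differentiable_continuous/derivable1_diffP. Qed.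

Lemma derive1_near_cst (f : R -> R) (c x : R) :
  (\forall y \near x, f y = c) -> derive1 f x = 0.
Proof.
move=> fc; rewrite derive1E (@near_eq_derive _ _ _ f (cst c)) ?derive_cst//.
Qed.

Definition dstep : R -> R := derive1 (@step R).

Lemma continuous_dstep : continuous dstep.
Proof. by apply: derivable_continuous; have [_ []] := @diffn_step R 2. Qed.

Lemma dstep_eq0 x : 1 < `|x| -> dstep x = 0.
Proof.
rewrite real_ltr_normr ?num_real// => /orP[x1|x1].
  apply: (@derive1_near_cst _ 1); near=> y; apply: step1.
  by apply: ltW; near: y; exact: lt_nbhsr.
have {}x1 : x < -1 by lra.
apply: (@derive1_near_cst _ 0); near=> y; apply: step0.
by apply: ltW; near: y; exact: lt_nbhsl.
Unshelve. all: by end_near. Qed.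

Lemma dstep_bounded : exists2 C : R, 0 < C & forall x, `|dstep x| <= C.
Proof.
have := @segment_compact R (-1) 1 => /continuous_compact.
move=> /(_ _ _ (continuous_subspaceT continuous_dstep))/compact_bounded[M [_ MB]].
exists (`|M| + 1) => [|x]; first by rewrite ltr_wpDl.
have [x1|x1] := leP `|x| 1; last by rewrite dstep_eq0// normr0 addr_ge0.
apply: MB; first by rewrite (le_lt_trans (ler_norm M))// ltrDl.
by exists x => //=; rewrite in_itv/=; rewrite ler_norml in x1.
Qed.

(** The argument has the form [a * x + b] of [is_derive_affine]. For small [h] the derivative is a
    mollifier at [t], while the function itself approximates the Heaviside function at [t]. *)
Definition ramp (t h x : R) : R := step (h^-1 * x - h^-1 * t).

Lemma diffn_ramp n t h : diffn n (ramp t h).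
Proof. exact: diffn_affine (diffn_step _). Qed.

Lemma derive1_ramp t h x : derive1 (ramp t h) x = h^-1 * dstep (h^-1 * x - h^-1 * t).
Proof.
have ds y : derivable (@step R) y 1 by have [] := @diffn_step R 1.
by rewrite derive1E; have [_ ->] := @is_derive_affine R step h^-1 (- (h^-1 * t)) x (ds _).
Qed.

Lemma ramp_ge0 t h x : 0 <= ramp t h x. Proof. exact: step_ge0. Qed.

Lemma ramp_le1 t h x : ramp t h x <= 1. Proof. exact: step_le1. Qed.

Lemma ramp0 t h x : 0 < h -> x <= t - h -> ramp t h x = 0.
Proof.
by move=> h0 xt; apply: step0; rewrite -mulrBr ler_pdivrMl//; lra.
Qed.

Lemma ramp1 t h x : 0 < h -> t + h <= x -> ramp t h x = 1.
Proof.
by move=> h0 xt; apply: step1; rewrite -mulrBr ler_pdivlMl//; lra.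
Qed.

Lemma derive1_ramp_eq0 t h x : 0 < h -> h < `|x - t| -> derive1 (ramp t h) x = 0.
Proof.
move=> h0 hx; rewrite derive1_ramp dstep_eq0 ?mulr0// -mulrBr normrM.
by rewrite gtr0_norm ?invr_gt0// ltr_pdivlMl// mulr1.
Qed.

Lemma continuous_derive1_ramp t h : continuous (derive1 (ramp t h)).
Proof. by apply: derivable_continuous; have [_ []] := @diffn_ramp 2 t h. Qed.

Lemma integrable_derive1_ramp t h : 0 < h ->
  mu.-integrable setT (EFin \o derive1 (ramp t h)).
Proof.
move=> h0.
have i1 : mu.-integrable `[t - h, t + h] (EFin \o derive1 (ramp t h)).
  apply: continuous_compact_integrable; first exact: segment_compact.
  exact/continuous_subspaceT/continuous_derive1_ramp.
move/integrable_mkcond : i1 => /(_ (measurable_itv _)).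
congr (_.-integrable _ _); apply/funext => x; rewrite patchE; case: ifPn => //=.
rewrite notin_setE/= in_itv/= => /negP; rewrite negb_and -!ltNge => hx.
rewrite derive1_ramp_eq0//; case/orP: hx => hx; last by rewrite gtr0_norm; lra.
by rewrite ltr0_norm; lra.
Qed.

Lemma integral_derive1_ramp t h : 0 < h ->
  \int[mu]_x derive1 (ramp t h) x = 1.
Proof.
move=> h0.
have dr x : derivable (ramp t h) x 1 by have [] := @diffn_ramp 1 t h.
have cr := derivable_continuous dr.
have e : (\int[mu]_(x in `[(t - h)%R, (t + h)%R]) (derive1 (ramp t h) x)%:E =
    (ramp t h (t + h)%R)%:E - (ramp t h (t - h)%R)%:E)%E.
  apply: continuous_FTC2; last by [].
  - by lra.
  - exact/continuous_subspaceT/continuous_derive1_ramp.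
  - split; first by move=> x _; exact: dr.
      by apply: cvg_at_right_filter; exact: cr.
    by apply: cvg_at_left_filter; exact: cr.
rewrite ramp1 ?ramp0// sube0 in e.
rewrite /Rintegral -[RHS]/(fine 1%:E) -e [X in _ = fine X]integral_mkcond; congr fine.
apply: eq_integral => x _; rewrite patchE; case: ifPn => //.
rewrite notin_setE/= in_itv/= => /negP; rewrite negb_and -!ltNge => hx.
rewrite derive1_ramp_eq0//; case/orP: hx => hx; last by rewrite gtr0_norm; lra.
by rewrite ltr0_norm; lra.
Qed.

(** The mollifier has integral 1, is bounded by [C / h] and vanishes farther than [h] from [t].
    Hence the error is at most [C / h] times the integral of [|g - g t|] over a ball of radius
    comparable to [h], a multiple of the average that tends to 0 at a Lebesgue point. *)
Lemma mollify_lebesgue_pt (g : R -> R) t :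
  mu.-integrable setT (EFin \o g) -> lebesgue_pt g t ->
  \int[mu]_x (g x * derive1 (ramp t n.+1%:R^-1) x) @[n --> \oo] --> g t.
Proof.
move=> gi gt.
have [C C0 dC] := dstep_bounded.
pose h n : R := n.+1%:R^-1.
have h0 n : 0 < h n by rewrite invr_gt0.
(* The ball is open, whereas the mollifier is only known to vanish at distances strictly larger than
   [h]; radius [2 h] leaves room. The ball has measure [4 h], hence the factor 4 below. *)
pose r n := 2 * h n.
have r0 n : 0 < r n by rewrite mulr_gt0.
have rcvg : r @ \oo --> 0^'+.
  move=> P /= [e /= e0 eP]; have e20 : 0 < e / 2 by rewrite divr_gt0.
  suff : \forall n \near \oo, P (r n) by [].
  near=> n; apply: eP => //.
  suff : `|0 - r n| < e by [].
  rewrite sub0r normrN gtr0_norm// /r.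
  have : h n < (PosNum e20)%:num by near: n; exact: near_infty_natSinv_lt.
  by rewrite /=; lra.
have {gt}gt : davg g t (r n) @[n --> \oo] --> 0%E.
  exact: (cvg_comp _ _ rcvg gt).
have /fine_cvgP[fin gt'] := gt.
have key : \forall n \near \oo,
    `|\int[mu]_x (g x * derive1 (ramp t (h n)) x) - g t| <= 4 * C * fine (davg g t (r n)).
  near=> n.
  have mdr : measurable_fun setT (derive1 (ramp t (h n))).
    by apply: open_continuous_measurable_fun; [exact: openT|move=> x _; exact: continuous_derive1_ramp].
  have dr x : `|derive1 (ramp t (h n)) x| <= (h n)^-1 * C.
    by rewrite derive1_ramp normrM gtr0_norm ?invr_gt0// ler_wpM2l// invr_ge0 ltW.
  have gdi := integrable_mulr_bounded measurableT gi mdr (fun x _ => dr x).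
  have di := integrable_derive1_ramp t (h0 n).
  have -> : g t = \int[mu]_x (g t * derive1 (ramp t (h n)) x).
    by rewrite RintegralZl// integral_derive1_ramp// mulr1.
  have di' : mu.-integrable setT (EFin \o (fun x => g t * derive1 (ramp t (h n)) x)).
    rewrite (_ : _ \o _ = (fun x => (g t)%:E * (EFin \o (derive1 (ramp t (h n)))) x)%E)//.
    exact: integrableZl.
  rewrite -RintegralB//.
  have mB : measurable (ball t (r n)) by exact: measurable_ball.
  rewrite -lee_fin EFin_normr_Rintegral//; last first.
    rewrite (_ : _ \o _ = (EFin \o (fun x => g x * derive1 (ramp t (h n)) x)%R) \-
      (EFin \o (fun x => g t * derive1 (ramp t (h n)) x)%R))%E//.
    exact: integrableB.
  have mg : measurable_fun setT g by move/integrableP : gi => [/measurable_EFinP].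
  apply: (le_trans (le_abse_integral _ measurableT _)).
    apply/measurable_EFinP; apply: measurable_funB; apply: measurable_funM => //.
  have -> : ((4 * C * fine (davg g t (r n)))%R%:E = ((h n)^-1 * C)%R%:E *
       \int[mu]_(y in ball t (r n)) `| (g y - g t)%R%:E |)%E.
    rewrite EFinM fineK; last by near: n.
    rewrite /davg /iavg (lebesgue_measure_ball _ (ltW (r0 n))) muleA.
    congr (_ * _)%E; rewrite inver mulrn_eq0/= gt_eqF// -EFinM; congr (_%:E).
    rewrite /r mulrC -mulr_natr; have := h0 n => /lt0r_neq0 hn; field.
    by rewrite hn.
  rewrite -ge0_integralZl//; last 2 first.
    - apply/measurable_EFinP; apply: measurableT_comp => //.
      by apply: measurable_funB => //; exact: measurable_funS mg.
    - by rewrite lee_fin mulr_ge0 ?invr_ge0// ltW.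
  rewrite [leRHS]integral_mkcond; apply: ge0_le_integral => //.
  - apply/measurable_EFinP; apply: measurableT_comp => //.
    by apply: measurable_funB; apply: measurable_funM => //.
  - have mr : measurable_fun (ball t (r n))
        (EFin \o (fun x => (h n)^-1 * C * `|g x - g t|)).
      apply/measurable_EFinP; apply: measurable_funM => //.
      apply: measurableT_comp => //.
      by apply: measurable_funB => //; exact: measurable_funS mg.
    exact: (iffLR (measurable_restrictT _ mB) mr).
  move=> x _; rewrite patchE; case: ifPn => [xB|].
    rewrite -EFinM lee_fin -mulrBl normrM mulrC; apply: ler_wpM2r => //; exact: dr.
  rewrite notin_setE /ball/= => /negP; rewrite -leNgt => xt.
  rewrite derive1_ramp_eq0 ?mulr0 ?subrr ?normr0// distrC (lt_le_trans _ xt)//.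
  by rewrite /r; have := h0 n; lra.
apply/cvgrPdist_le => e e0.
have e1 : 0 < e / (4 * C) by rewrite divr_gt0// mulr_gt0.
move/cvgrPdist_le : gt' => /(_ _ e1) gt'.
near=> n; rewrite distrC.
have /le_trans -> // : `|\int[mu]_x (g x * derive1 (ramp t (h n)) x) - g t|
    <= 4 * C * fine (davg g t (r n)) by near: n.
rewrite mulrC -ler_pdivlMr ?mulr_gt0//.
have : `|0 - (fine \o (fun n => davg g t (r n))) n| <= e / (4 * C) by near: n.
by rewrite sub0r normrN => /(le_trans _); apply; exact: ler_norm.
Unshelve. all: by end_near. Qed.

(** Lebesgue differentiation is applied to the restrictions of [f] to the compact intervals [K m],
    for all [m] outside one null set. Near a given [t] the mollifier eventually sees only one of
    them. *)
Lemma mollify (f : R -> R) : locally_integrable unit_itv f ->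
  {ae mu, forall t, unit_itv t ->
    \int[mu]_(x in unit_itv) (f x * derive1 (ramp t n.+1%:R^-1) x) @[n --> \oo] --> f t}.
Proof.
move=> [mf _ fK].
pose K m : set R := `[m.+1%:R^-1, 1 - m.+1%:R^-1]%classic.
have KU m : K m `<=` unit_itv.
  move=> x; rewrite /K /unit_itv/= !in_itv/= => /andP[x1 x2].
  have : 0 < m.+1%:R^-1 :> R by rewrite invr_gt0.
  by move: m.+1%:R^-1 x1 x2 => a x1 x2 a0; apply/andP; split; lra.
have mK m : measurable (K m) by exact: measurable_itv.
have fi m : mu.-integrable setT (EFin \o (f \_ (K m))).
  have : mu.-integrable (K m) (EFin \o f).
    apply/integrableP; split.
      apply/measurable_EFinP; apply: measurable_funS mf => //.
      exact: measurable_unit_itv.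
    by apply: fK => //; exact: segment_compact.
  by move=> i; rewrite -restrict_EFin; exact: (iffLR (@integrable_mkcond _ _ _ mu _ _ (mK m)) i).
have fae m : {ae mu, forall x, lebesgue_pt (f \_ (K m)) x}.
  by apply/lebesgue_differentiation/open_integrable_locally => //; exact: openT.
apply: (aeS (ae_foralln fae)) => t ft t01.
move: t01; rewrite /unit_itv/= in_itv/= => /andP[t0 t1].
(* The margins are halved: one half keeps the ends of [K m] away from 0 and 1, the other
   accommodates the width of the mollifier. *)
have [m [mt0 mt1]] : exists m, m.+1%:R^-1 < t / 2 /\ m.+1%:R^-1 < (1 - t) / 2.
  have e0 : 0 < Num.min (t / 2) ((1 - t) / 2).
    by rewrite lt_min; apply/andP; split; lra.
  have [m _ /(_ m (leqnn m))] := near_infty_natSinv_lt (PosNum e0).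
  by rewrite /= lt_min => /andP[? ?]; exists m.
have -> : f t = (f \_ (K m)) t.
  rewrite patchE ifT// inE /K/= in_itv/=.
  by move: m.+1%:R^-1 mt0 mt1 => a mt0 mt1; apply/andP; split; lra.
apply: cvg_trans (mollify_lebesgue_pt (fi m) (ft m)); apply: near_eq_cvg.
near=> n.
rewrite [RHS]Rintegral_mkcond; apply: eq_Rintegral => x _.
have hm : n.+1%:R^-1 <= m.+1%:R^-1 :> R.
  by rewrite lef_pV2 ?posrE// ler_nat ltnS; near: n; exact: nbhs_infty_ge.
rewrite !patchE (_ : point = 0 :> R)//.
case: ifPn => xK; case: ifPn => xU //.
- exfalso; move: xU; rewrite notin_setE; apply; apply: (KU m).
  by move: xK; rewrite inE.
- rewrite mul0r derive1_ramp_eq0 ?mulr0//.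
  move: xK; rewrite notin_setE /K/= in_itv/= => /negP; rewrite negb_and -!ltNge => xK.
  have := ler_norm (x - t); have := ler_norm (- (x - t)); rewrite normrN.
  by move: m.+1%:R^-1 n.+1%:R^-1 hm mt0 mt1 xK => a b hm mt0 mt1 /orP[]; lra.
- by rewrite mul0r.
Unshelve. all: by end_near. Qed.

End Mollification.

(** * Pointwise representation of weakly differentiable functions *)

Section WeakDerivatives.
Context {R : realType}.
Local Notation mu := (@lebesgue_measure R).
Local Notation D := (@unit_itv R).

Lemma test_functionP (phi : R -> R) (a b : R) : smooth phi -> 0 < a -> b < 1 ->
  (forall x, phi x != 0 -> a <= x <= b) -> test_function phi.
Proof.
move=> sphi a0 b1 phi0.
have sub : closure [set x | phi x != 0] `<=` `[a, b]%classic.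
  rewrite [X in _ `<=` X](closure_id `[a, b]%classic).1; last exact: interval_closed.
  by apply: closure_subset => x /phi0; rewrite /= in_itv/=.
split => //.
- apply: subclosed_compact sub; first exact: closed_closure.
  exact: segment_compact.
- move=> x /sub; rewrite /unit_itv/= !in_itv/= => /andP[ax xb].
  by apply/andP; split; lra.
Qed.

Lemma smooth_derive1 (phi : R -> R) : smooth phi -> smooth (derive1 phi).
Proof. by move=> sphi n x; rewrite -derive1Sn; exact: sphi. Qed.

Lemma test_function_derive1 (phi : R -> R) : test_function phi ->
  test_function (derive1 phi).
Proof.
move=> [sphi cphi Uphi].
have sub : closure [set x | derive1 phi x != 0] `<=` closure [set x | phi x != 0].
  rewrite [X in _ `<=` X](closure_id _).1; last exact: closed_closure.
  apply: closure_subset => x /= dx; apply: contrapT => xN.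
  have oN : open (~` closure [set x | phi x != 0]).
    by apply: closed_openC; exact: closed_closure.
  move/eqP : dx; apply; apply: (@derive1_near_cst _ _ 0).
  have : \forall y \near x, (~` closure [set x | phi x != 0]) y by exact: open_nbhs_nbhs.
  apply: filterS => y yN; apply/eqP/negPn/negP => h; apply: yN.
  exact: subset_closure.
split; first exact: smooth_derive1.
- by apply: subclosed_compact sub => //; exact: closed_closure.
- exact: subset_trans Uphi.
Qed.

(** A single ramp equals 1 up to the right end and beyond, so it is no test function. Two ramps
    agree near both ends, and their difference has compact support. *)
Lemma test_function_ramp (t h s k : R) : 0 < h -> 0 < k ->
  0 < t - h -> t + h < 1 -> 0 < s - k -> s + k < 1 ->
  test_function (fun x => ramp t h x - ramp s k x).
Proof.
move=> h0 k0 th0 th1 sk0 sk1.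
apply: (@test_functionP _ (Num.min (t - h) (s - k)) (Num.max (t + h) (s + k))).
- apply: smooth_diffn => n; apply: diffnD; first exact: diffn_ramp.
  have -> : (fun x => - ramp s k x) = (fun x => cst (-1) x * ramp s k x).
    by apply/funext => x; rewrite mulN1r.
  by apply: diffnM; [exact: diffn_cst|exact: diffn_ramp].
- by rewrite lt_min th0.
- by rewrite gt_max th1.
- move=> x; apply: contraNT; rewrite negb_and -!ltNge lt_min gt_max.
  by case/orP => /andP[x1 x2]; rewrite ?(ramp0 h0 (ltW x1)) ?(ramp0 k0 (ltW x2))
    ?(ramp1 h0 (ltW x1)) ?(ramp1 k0 (ltW x2)) subrr.
Qed.

Lemma test_function_derive1_ramp (t h : R) : 0 < h -> 0 < t - h -> t + h < 1 ->
  test_function (derive1 (ramp t h)).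
Proof.
move=> h0 th0 th1; apply: (@test_functionP _ (t - h) (t + h)) => //.
  by apply: smooth_derive1; apply: smooth_diffn => n; exact: diffn_ramp.
move=> x; apply: contraNT; rewrite negb_and -!ltNge => xth.
rewrite derive1_ramp_eq0// real_ltr_normr ?num_real//.
by case/orP: xth => ?; apply/orP; [right|left]; lra.
Qed.

Lemma near_unit_itv (t : R) : D t ->
  \forall n \near \oo, 0 < t - n.+1%:R^-1 /\ t + n.+1%:R^-1 < 1.
Proof.
rewrite /unit_itv/= in_itv/= => /andP[t0 t1].
have e0 : 0 < Num.min t (1 - t) by rewrite lt_min t0 subr_gt0.
have := near_infty_natSinv_lt (PosNum e0); apply: filterS => n /=.
rewrite lt_min; move: n.+1%:R^-1 => a /andP[? ?].
by split; lra.
Qed.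

(** The fundamental lemma of the calculus of variations: mollifiers are themselves test functions,
    and they recover [f] almost everywhere. *)
Lemma ae_eq0_test_function (f : R -> R) : locally_integrable D f ->
  (forall phi, test_function phi -> \int[mu]_(x in D) (f x * phi x) = 0) ->
  {ae mu, forall t, D t -> f t = 0}.
Proof.
move=> lf f0; apply: (aeS (mollify lf)) => t ft Dt.
have /cvg_lim <- // := ft Dt; apply/cvg_lim => //.
apply: cvg_near_cst; have := near_unit_itv Dt; apply: filterS => n [n0 n1].
by apply: f0; exact: test_function_derive1_ramp.
Qed.

(** The value [step 0] at [x = t] is that of every [ramp t h], so that the ramps converge at every
    point. *)
Definition heaviside (t x : R) : R := if x < t then 0 else if t < x then 1 else step 0.

Lemma cvg_ramp (t x : R) : ramp t n.+1%:R^-1 x @[n --> \oo] --> heaviside t x.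
Proof.
rewrite /heaviside; case: ltgtP => [xt|tx|->].
- have e0 : 0 < t - x by rewrite subr_gt0.
  apply: cvg_near_cst; have := near_infty_natSinv_lt (PosNum e0).
  apply: filterS => n /= h; apply: ramp0; first by rewrite invr_gt0.
  by move: n.+1%:R^-1 h => a h; lra.
- have e0 : 0 < x - t by rewrite subr_gt0.
  apply: cvg_near_cst; have := near_infty_natSinv_lt (PosNum e0).
  apply: filterS => n /= h; apply: ramp1; first by rewrite invr_gt0.
  by move: n.+1%:R^-1 h => a h; lra.
- by apply: cvg_near_cst; apply: nearW => n; rewrite /ramp subrr.
Qed.

Lemma measurable_ramp (t h : R) : measurable_fun setT (ramp t h).
Proof.
apply: continuous_measurable_fun; apply: derivable_continuous => x.
by have [] := @diffn_ramp R 1 t h.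
Qed.

(** Centre and width keep the transition inside [1/4, 3/4], hence away from the ends of the unit
    interval. *)
Definition anchor : R -> R := ramp (2^-1) (4^-1).

(* The primitive, vanishing near 0 and 1, of the difference between the Dirac
   mass at [t] and the fixed bump [derive1 anchor]. *)
Definition rep_kernel (t x : R) := heaviside t x - anchor x.

Lemma measurable_rep_kernel t : measurable_fun setT (rep_kernel t).
Proof.
apply: measurable_funB; last exact: measurable_ramp.
apply: (@measurable_fun_cvg _ _ _ _ (fun n => ramp t n.+1%:R^-1)) => [n|x _].
  exact: measurable_ramp.
exact: cvg_ramp.
Qed.

Lemma rep_kernel_le1 t x : `|rep_kernel t x| <= 1.
Proof.
rewrite /rep_kernel /anchor.
have a0 := ramp_ge0 2^-1 4^-1 x; have a1 := ramp_le1 2^-1 4^-1 x.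
have [h0 h1] : 0 <= heaviside t x /\ heaviside t x <= 1.
  by rewrite /heaviside; do 2 case: ifP => _ //; rewrite step_ge0 step_le1.
by rewrite ler_norml; apply/andP; split; lra.
Qed.

Lemma measurable_derive1_ramp (t h : R) : measurable_fun setT (derive1 (ramp t h)).
Proof. by apply: continuous_measurable_fun; exact: continuous_derive1_ramp. Qed.

Lemma derive1_ramp_bounded (t h : R) : exists M : R, forall x, `|derive1 (ramp t h) x| <= M.
Proof.
have [C C0 dC] := @dstep_bounded R; exists (`|h^-1| * C) => x.
by rewrite derive1_ramp normrM ler_wpM2l.
Qed.

(** The test function is [ramp t h - anchor], whose derivative is a mollifier at [t] minus a fixed
    bump. As [h] tends to 0, the side of [f] converges by [mollify] and the side of [g] by dominated
    convergence, the kernels being bounded by 1. *)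
Lemma weak_derivative_rep (f g : R -> R) :
  mu.-integrable D (EFin \o f) -> mu.-integrable D (EFin \o g) ->
  (forall phi, test_function phi ->
    \int[mu]_(x in D) (f x * derive1 phi x) = - \int[mu]_(x in D) (g x * phi x)) ->
  {ae mu, forall t, D t -> f t = \int[mu]_(x in D) (f x * derive1 anchor x)
     - \int[mu]_(x in D) (g x * rep_kernel t x)}.
Proof.
move=> fi gi fg.
have mD : measurable D := measurable_unit_itv.
have oD : open D by exact: interval_open.
apply: (aeS (mollify (open_integrable_locally oD fi))) => t ft Dt.
have h1 := ft Dt.
have h2 : \int[mu]_(x in D) (f x * derive1 anchor x) -
    \int[mu]_(x in D) (g x * (ramp t n.+1%:R^-1 x - anchor x)) @[n --> \oo]
    --> \int[mu]_(x in D) (f x * derive1 anchor x)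
     - \int[mu]_(x in D) (g x * rep_kernel t x).
  apply: cvgB; first exact: cvg_cst.
  apply: (@cvg_Rintegral_mulr_bounded _ _ _ mu D mD g _ _ 1) => // [n|n x _|x _].
  - apply: measurable_funS (measurable_funB (measurable_ramp _ _) (measurable_ramp _ _)) => //.
  - have := ramp_ge0 t n.+1%:R^-1 x; have := ramp_le1 t n.+1%:R^-1 x.
    have := ramp_ge0 2^-1 4^-1 x; have := ramp_le1 2^-1 4^-1 x.
    by rewrite /anchor ler_norml => *; apply/andP; split; lra.
  - by apply: cvgB; [exact: cvg_ramp|exact: cvg_cst].
have E : \forall n \near \oo,
    \int[mu]_(x in D) (f x * derive1 (ramp t n.+1%:R^-1) x) =
    \int[mu]_(x in D) (f x * derive1 anchor x) -
    \int[mu]_(x in D) (g x * (ramp t n.+1%:R^-1 x - anchor x)).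
  have := near_unit_itv Dt; apply: filterS => n [n0 n1].
  have hn : 0 < n.+1%:R^-1 :> R by rewrite invr_gt0.
  have T : test_function (fun x => ramp t n.+1%:R^-1 x - anchor x).
    by apply: test_function_ramp => //; lra.
  have dr u k x : derivable (ramp u k : R -> R) x 1 by have [] := @diffn_ramp R 1 u k.
  have := fg _ T.
  have -> : derive1 (fun x => ramp t n.+1%:R^-1 x - anchor x) =
      (fun x => derive1 (ramp t n.+1%:R^-1) x - derive1 anchor x).
    by apply/funext => x; rewrite !derive1E deriveB//; exact: dr.
  under eq_Rintegral do rewrite mulrBr.
  have [M MP] := derive1_ramp_bounded t n.+1%:R^-1.
  have [M' MP'] := derive1_ramp_bounded 2^-1 4^-1.
  rewrite RintegralB//; first by move=> /eqP; rewrite subr_eq addrC => /eqP ->.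
    apply: (@integrable_mulr_bounded _ _ R mu D mD f (derive1 (ramp t n.+1%:R^-1)) M) => //.
    by apply: measurable_funS (measurable_derive1_ramp _ _).
  apply: (@integrable_mulr_bounded _ _ R mu D mD f (derive1 anchor) M') => //.
  by apply: measurable_funS (measurable_derive1_ramp _ _).
exact: (cvg_unique _ (cvg_trans (near_eq_cvg E) h1) h2).
Qed.

End WeakDerivatives.

(** * Products of locally integrable functions with test functions *)

Section LocallyIntegrable.
Context {R : realType}.
Local Notation mu := (@lebesgue_measure R).
Local Notation D := (@unit_itv R).

Lemma locally_integrable_scale (A : set R) (f : R -> R) (a : R) :
  locally_integrable A f -> locally_integrable A (fun x => a * f x).
Proof.
move=> [mf oA fK]; split => //; first exact: measurable_funM.
move=> K KA cK.
have mK : measurable K by exact: compact_measurable.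
have -> : (\int[mu]_(x in K) `|a * f x|%:E = `|a|%:E * \int[mu]_(x in K) `|f x|%:E)%E.
  rewrite -ge0_integralZl//.
    by apply: eq_integral => x _; rewrite normrM EFinM.
  apply/measurable_EFinP/measurableT_comp => //.
  by apply: measurable_funS mf => //; exact: open_measurable.
by rewrite lte_mul_pinfty// fK.
Qed.

Lemma measurable_test_function (phi : R -> R) : test_function phi ->
  measurable_fun setT phi.
Proof.
move=> [sphi _ _]; apply: continuous_measurable_fun; apply: derivable_continuous.
exact: (sphi 0%N).
Qed.

Lemma integrable_mul_test_function (f phi : R -> R) :
  locally_integrable D f -> test_function phi ->
  mu.-integrable D (EFin \o (fun x => f x * phi x)).
Proof.
move=> [mf oD fK] tphi; have mphi := measurable_test_function tphi.
case: tphi => sphi cK KD; set K := closure _ in cK KD.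
have mK : measurable K by exact: compact_measurable.
have phi0 x : ~ K x -> phi x = 0.
  by move=> NK; apply/eqP/negPn/negP => h; apply: NK; exact: subset_closure.
have cphi : continuous phi by apply: derivable_continuous; exact: (sphi 0%N).
have [M [_ MB]] := compact_bounded (continuous_compact (continuous_subspaceT cphi) cK).
have phiM x : K x -> `|phi x| <= `|M| + 1.
  by move=> Kx; apply: MB; [rewrite (le_lt_trans (ler_norm M))// ltrDl|exists x].
have fi : mu.-integrable K (EFin \o f).
  apply/integrableP; split; last exact: fK.
  by apply/measurable_EFinP; apply: measurable_funS mf => //; exact: measurable_unit_itv.
have fpi : mu.-integrable K (EFin \o (fun x => f x * phi x)).
  apply: (@integrable_mulr_bounded _ _ R mu K mK f phi (`|M| + 1)) => //.
  exact: measurable_funS mphi.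
have := iffLR (@integrable_mkcond _ _ _ mu _ _ mK) fpi.
have -> : (EFin \o (fun x => f x * phi x)) \_ K = EFin \o (fun x => f x * phi x).
  apply/funext => x; rewrite patchE; case: ifPn => //.
  by rewrite notin_setE => /phi0 /= ->; rewrite mulr0.
by apply: integrableS => //; exact: measurable_unit_itv.
Qed.

End LocallyIntegrable.

(** * Weak convergence in the Sobolev space *)

Section Sobolev3.
Context {R : realType}.
Local Notation mu := (@lebesgue_measure R).
Local Notation D := (@unit_itv R).
Local Notation curve := (R -> 'rV[R]_3).
Implicit Types (u v g h : curve) (n : nat) (j : 'I_3).

Let mD : @measurable _ (measurableTypeR R) D := measurable_unit_itv.

Lemma open_unit_itv : open D. Proof. exact: interval_open. Qed.

Lemma lebesgue_measure_unit_itv : mu D = 1%E.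
Proof. by rewrite /unit_itv lebesgue_measure_itv/= lte_fin ltr01 sube0. Qed.

Lemma lebesgue_measure_unit_itv_lty : (mu D < +oo)%E.
Proof. by rewrite lebesgue_measure_unit_itv ltry. Qed.

(** The interval has finite measure, so the constant 1 is integrable, and [|y| <= 1 + |y|^p]. *)
Lemma in_Lp_integrable (p : R) g j : 1 < p -> in_Lp p g ->
  mu.-integrable D (EFin \o (fun x => g x 0 j)).
Proof.
move=> p1 /(_ j) gp.
have mg : measurable_fun D (fun x => g x 0 j).
  by apply: (iffRL (measurable_restrictT _ mD)); move: gp; rewrite inE => /andP[/[!inE]].
have ip := Lfun_integrable (ltW p1) gp.
have i1 : mu.-integrable D (EFin \o cst (1 : R)).
  apply: measurable_bounded_integrable => //.
    exact: lebesgue_measure_unit_itv_lty.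
  by apply: (@bounded_on _ _ _ _ _ 1) => x _; rewrite normr1.
have i2 := integrableD mD i1 (integrableS measurableT mD (@subsetT _ _) ip).
apply: le_integrable i2 => //; first exact/measurable_EFinP.
move=> x Dx.
have H : `|g x 0 j| <= 1 + `|g x 0 j| `^ p.
  have [h|h] := leP `|g x 0 j| 1; first by rewrite (le_trans h)// lerDl powR_ge0.
  by rewrite -[leLHS]powRr1// (le_trans (ler_powR (ltW h) (ltW p1)))// lerDr.
rewrite -lee_fin in H; rewrite /= patchE mem_set//; apply: (le_trans H).
by rewrite EFinD; exact: lee_abs.
Qed.

Lemma weak_derivative_unique n u g h : is_weak_derivative n u g ->
  is_weak_derivative n u h -> forall j, {ae mu, forall t, D t -> g t 0 j = h t 0 j}.
Proof.
move=> ug uh j; have [gl gphi] := ug j; have [hl hphi] := uh j.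
have := ae_eq0_test_function (locally_integrableB gl hl).
move=> H; apply: (aeS (H _)) => [phi tphi|t ft Dt]; last first.
  by apply/eqP; rewrite -subr_eq0; apply/eqP; exact: ft.
have e : \int[mu]_(x in D) (g x 0 j * phi x) = \int[mu]_(x in D) (h x 0 j * phi x).
  have := gphi _ tphi; rewrite (hphi _ tphi) => /esym.
  by apply: mulfI; rewrite expf_neq0// oppr_eq0 oner_eq0.
under eq_Rintegral do rewrite mulrBl.
by rewrite RintegralB ?e ?subrr//; exact: integrable_mul_test_function.
Qed.

Lemma weak_derivative_linear n (a : R) u v g h :
  (forall j, locally_integrable D (fun x => u x 0 j)) ->
  (forall j, locally_integrable D (fun x => v x 0 j)) ->
  is_weak_derivative n u g -> is_weak_derivative n v h ->
  is_weak_derivative n (a *: u + v) (a *: g + h).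
Proof.
move=> ul vl ug vh j; have [gl gphi] := ug j; have [hl hphi] := vh j.
split=> [|phi tphi].
  have := locally_integrableD (locally_integrable_scale a gl) hl.
  by congr locally_integrable; apply/funext => x; rewrite /= !fctE !mxE.
have lin (w z : curve) psi : locally_integrable D (fun x => w x 0 j) ->
    locally_integrable D (fun x => z x 0 j) -> test_function psi ->
    \int[mu]_(x in D) ((a *: w + z) x 0 j * psi x) =
    a * \int[mu]_(x in D) (w x 0 j * psi x) + \int[mu]_(x in D) (z x 0 j * psi x).
  move=> wl zl tpsi.
  have wi := integrable_mul_test_function wl tpsi.
  have zi := integrable_mul_test_function zl tpsi.
  rewrite -RintegralZl// -RintegralD//.
    by apply: eq_Rintegral => x _; rewrite /= !fctE !mxE mulrDl mulrA.
  rewrite (_ : EFin \o _ = (fun x => a%:E * (EFin \o (fun x => w x 0 j * psi x)%R) x)%E)//.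
  exact: integrableZl.
have tn m : test_function (derive1n m phi).
  by elim: m => // m IH; rewrite derive1nS; exact: test_function_derive1.
rewrite (lin _ _ _ (ul j) (vl j) (tn n)) (lin _ _ _ gl hl tphi).
by rewrite gphi// hphi// mulrDr mulrCA.
Qed.

(** Testing [g] with [derive1 phi] and [h] with [phi] brings in the same derivative of order [n + 1]
    of [phi] against [u]. Thus [h] is a first weak derivative of [g], which makes the representation
    formula applicable to [wderiv]. *)
Lemma weak_derivative_step n u g h j (phi : R -> R) :
  is_weak_derivative n u g -> is_weak_derivative n.+1 u h -> test_function phi ->
  \int[mu]_(x in D) (g x 0 j * derive1 phi x) = - \int[mu]_(x in D) (h x 0 j * phi x).
Proof.
move=> ug uh tphi; have [_ gphi] := ug j; have [_ hphi] := uh j.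
have := gphi _ (test_function_derive1 tphi).
rewrite -derive1Sn hphi// exprS mulN1r mulNr -mulrN => /esym.
by apply: mulfI; rewrite expf_neq0// oppr_eq0 oner_eq0.
Qed.

Variables (p : R) (p1 : 1 < p).
Local Notation W := (@sobolev R 3 p).

Lemma sobolev_locally_integrable u j : W u -> locally_integrable D (fun x => u x 0 j).
Proof.
move=> [up _]; apply: (open_integrable_locally open_unit_itv).
exact: in_Lp_integrable p1 up.
Qed.

Lemma wderivP n u : W u -> (0 < n <= 3)%N -> is_weak_derivative n u (wderiv n u).
Proof.
move=> [_ ud] n3; have [g [_ gd]] := ud _ n3.
by apply: (@xgetPex _ (cst 0) [set g | is_weak_derivative n u g]); exists g.
Qed.

(** The representative picked by [wderiv] need not be the one given in L^p; integrability passes to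
    it because the two agree almost everywhere. *)
Lemma wderiv_integrable n u j : W u -> (0 < n <= 3)%N ->
  mu.-integrable D (EFin \o (fun x => wderiv n u x 0 j)).
Proof.
move=> Wu n3; have ud := wderivP Wu n3.
have [g [gp gd]] := Wu.2 _ n3.
have [[mu' _ _] _] := ud j.
apply: (@ae_integrable _ _ R mu D mD (fun x => g x 0 j)) => //.
  exact: weak_derivative_unique gd ud j.
exact: in_Lp_integrable p1 gp.
Qed.

Lemma measurable_wderiv n u j : W u -> (0 < n <= 3)%N ->
  measurable_fun D (fun x => wderiv n u x 0 j).
Proof. by move=> Wu /(wderivP Wu)/(_ j)[[]]. Qed.

(** Since [wderiv] is a choice, it is linear only up to null sets. Two weak derivatives of one curve
    are exhibited here, for the uniqueness lemma to compare. *)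
Lemma wderiv_combP n (a : R) u v : W u -> W v -> (0 < n <= 3)%N ->
  is_weak_derivative n (a *: u + v) (a *: wderiv n u + wderiv n v) /\
  is_weak_derivative n (a *: u + v) (wderiv n (a *: u + v)).
Proof.
move=> Wu Wv n3.
have H := @weak_derivative_linear n a u v _ _
  (fun j => sobolev_locally_integrable j Wu) (fun j => sobolev_locally_integrable j Wv)
  (wderivP Wu n3) (wderivP Wv n3).
split; first exact: H.
apply: (@xgetPex _ (cst 0) [set g | is_weak_derivative n (a *: u + v) g]).
by eexists; exact: H.
Qed.

Lemma wderiv_linear n (a : R) u v j : W u -> W v -> (0 < n <= 3)%N ->
  {ae mu, forall t, D t ->
     wderiv n (a *: u + v) t 0 j = a * wderiv n u t 0 j + wderiv n v t 0 j}.
Proof.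
move=> Wu Wv n3; have [H H'] := wderiv_combP a Wu Wv n3.
by apply: (aeS (weak_derivative_unique H' H j)) => t h Dt; rewrite h// !fctE !mxE.
Qed.

Lemma measurable_wderiv_comb n (a : R) u v j : W u -> W v -> (0 < n <= 3)%N ->
  measurable_fun D (fun x => wderiv n (a *: u + v) x 0 j).
Proof. by move=> Wu Wv n3; have [_ /(_ j)[[]]] := wderiv_combP a Wu Wv n3. Qed.

Lemma dotE (x y : 'rV[R]_3) : dot x y = \sum_(i < 3) x 0 i * y 0 i.
Proof. by rewrite /dot mxE; apply: eq_bigr => i _; rewrite mxE. Qed.

Lemma normr_le_enorm (x : 'rV[R]_3) j : `|x 0 j| <= enorm x.
Proof.
rewrite /enorm -sqrtr_sqr ler_sqrt ?sqr_ge0//; last first.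
  by rewrite dotE sumr_ge0// => i _; rewrite -expr2 sqr_ge0.
rewrite dotE (bigD1 j)//= expr2 lerDl sumr_ge0// => i _.
by rewrite -expr2 sqr_ge0.
Qed.

Lemma measurable_enorm (A : set R) g : measurable A ->
  (forall j, measurable_fun A (fun x => g x 0 j)) ->
  measurable_fun A (fun x => enorm (g x)).
Proof.
move=> mA mg; rewrite /enorm.
have -> : (fun x => Num.sqrt (dot (g x) (g x))) =
    Num.sqrt \o (fun x => \sum_(i < 3) g x 0 i * g x 0 i).
  by apply/funext => x /=; rewrite dotE.
apply: measurableT_comp => //; first by apply: continuous_measurable_fun; exact: sqrt_continuous.
by apply: measurable_sum => i; exact: measurable_funM.
Qed.

(** Hölder's inequality against the indicator of the interval, whose norm for the conjugate exponent
    [q] is 1 because the interval has measure 1. *)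
Lemma L1_le_Lp_norm g j : (forall j, measurable_fun D (fun x => g x 0 j)) ->
  (\int[mu]_(x in D) `|g x 0 j|%:E <= Lp_norm p g)%E.
Proof.
move=> mg; have mE := measurable_enorm mD mg.
pose q := p / (p - 1).
have p0 : 0 < p by rewrite (lt_trans _ p1).
have q0 : 0 < q by rewrite divr_gt0// subr_gt0.
have pq : p^-1 + q^-1 = 1.
  have pn0 : p != 0 by rewrite gt_eqF.
  have pn1 : p - 1 != 0 by rewrite gt_eqF// subr_gt0.
  by rewrite /q; field; rewrite pn0 pn1.
have m1 : measurable_fun setT (fun x : R => \1_D x : R) by exact: measurable_indic.
have mE' := iffLR (measurable_restrictT _ mD) mE.
have := hoelder mu mE' m1 p0 q0 pq.
have -> : ('N[mu]_q%:E[EFin \o (fun x : R => \1_D x : R)] = 1)%E.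
  have E x : (`|(EFin \o (fun x : R => \1_D x : R)) x| `^ q = (\1_D x)%:E)%E.
    rewrite /= indicE; case: (x \in D) => /=.
      by rewrite normr1 powR1.
    by rewrite normr0 powR0// gt_eqF.
  rewrite unlock; under eq_integral do rewrite E.
  rewrite (_ : (\int[mu]_x (\1_D x)%:E = 1)%E) ?poweR1r//.
  by rewrite integral_indic// setIT; exact: lebesgue_measure_unit_itv.
rewrite mule1; apply: le_trans.
rewrite Lnorm1 [leLHS]integral_mkcond; apply: ge0_le_integral => //.
- by move=> x _; apply: erestrict_ge0.
- apply: (iffLR (measurable_restrictT _ mD)); apply/measurable_EFinP.
  by apply: measurableT_comp => //; exact: mg.
- by apply/measurable_EFinP/measurableT_comp => //; exact: measurable_funM.
move=> x _ /=; rewrite !patchE indicE; case: ifPn => xD; last by rewrite (_ : point = 0%:E)// lee_fin.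
by rewrite mulr1 lee_fin (le_trans (normr_le_enorm _ _))// ler_norm.
Qed.

Definition pairing n j (psi : R -> R) u := \int[mu]_(x in D) (wderiv n u x 0 j * psi x).

(** The pairing is at most [M] times the L^1 norm of the derivative, hence at most [M] times one
    summand of the Sobolev norm. These are the functionals through which weak convergence is
    exploited. *)
Lemma pairing_bounded_functional n j (psi : R -> R) (M : R) : (0 < n <= 3)%N ->
  measurable_fun D psi -> (forall x, D x -> `|psi x| <= M) ->
  bounded_functional W (@sobolev_norm R 3 p) (pairing n j psi).
Proof.
move=> n3 mpsi psiM; split=> [a u v Wu Wv|].
  have i1 := integrable_mulr_bounded mD (wderiv_integrable j Wu n3) mpsi psiM.
  have i2 := integrable_mulr_bounded mD (wderiv_integrable j Wv n3) mpsi psiM.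
  have mu1 := measurable_wderiv j Wu n3.
  have mv1 := measurable_wderiv j Wv n3.
  rewrite /pairing -RintegralZl// -RintegralD//; last first.
    rewrite (_ : EFin \o _ = (fun x => a%:E * (EFin \o (fun x => wderiv n u x 0 j * psi x)%R) x)%E)//.
    exact: integrableZl.
  apply: ae_eq_Rintegral => //.
  - by apply: measurable_funM => //; exact: measurable_wderiv_comb.
  - by apply: measurable_funD; do ?apply: measurable_funM.
  - by apply: (aeS (wderiv_linear a j Wu Wv n3)) => x h Dx; rewrite h// mulrDl mulrA.
exists M => u Wu.
have M0 : 0 <= M.
  (* Any point of the interval shows that the bound is nonnegative. *)
  apply: le_trans (psiM 2^-1 _) => //.
  by rewrite /unit_itv/= in_itv/=; apply/andP; split; lra.
have ui := wderiv_integrable j Wu n3.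
have h1 := normr_Rintegral_mulr_le mD ui mpsi psiM.
rewrite -lee_fin in h1; apply: (le_trans h1); rewrite EFinM lee_wpmul2l//.
rewrite /Rintegral fineK; last first.
  have := integrable_norm ui => h; apply: (@integrable_fin_num _ _ _ mu D mD (fun x => `|wderiv n u x 0 j|%:E)).
  exact: h.
apply: (le_trans (L1_le_Lp_norm j _)); first by move=> i; exact: measurable_wderiv.
have n4 : (n < 4)%N by case/andP: n3.
rewrite /sobolev_norm (bigD1 (Ordinal n4))//= leeDl//.
by apply: sume_ge0 => i _; exact: Lnorm_ge0.
Qed.

Lemma weakly_converges_pairing (u_ : nat -> curve) u n j (psi : R -> R) (M : R) :
  weakly_converges W (@sobolev_norm R 3 p) u_ u ->
  (0 < n <= 3)%N -> measurable_fun D psi -> (forall x, D x -> `|psi x| <= M) ->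
  \int[mu]_(x in D) (wderiv n (u_ k) x 0 j * psi x) @[k --> \oo]
    --> \int[mu]_(x in D) (wderiv n u x 0 j * psi x).
Proof.
by move=> uu n3 mpsi psiM; exact: uu (pairing_bounded_functional j n3 mpsi psiM).
Qed.

Lemma wderiv_rep n u j : W u -> (0 < n < 3)%N ->
  {ae mu, forall t, D t -> wderiv n u t 0 j =
     \int[mu]_(x in D) (wderiv n u x 0 j * derive1 anchor x)
     - \int[mu]_(x in D) (wderiv n.+1 u x 0 j * rep_kernel t x)}.
Proof.
move=> Wu /andP[n0 n3].
have h1 : (0 < n <= 3)%N by rewrite n0 ltnW.
have h2 : (0 < n.+1 <= 3)%N by [].
apply: weak_derivative_rep.
- exact: wderiv_integrable.
- exact: wderiv_integrable.
- by move=> phi tphi; apply: weak_derivative_step => //; exact: wderivP.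
Qed.

Lemma weakly_converges_wderiv_ae (u_ : nat -> curve) u n j :
  (forall k, W (u_ k)) -> W u -> weakly_converges W (@sobolev_norm R 3 p) u_ u ->
  (0 < n < 3)%N ->
  {ae mu, forall t, D t -> wderiv n (u_ k) t 0 j @[k --> \oo] --> wderiv n u t 0 j}.
Proof.
move=> Wk Wu uu n3; have /andP[n0 n3'] := n3.
have h1 : (0 < n <= 3)%N by rewrite n0 ltnW.
have h2 : (0 < n.+1 <= 3)%N by [].
(* The exceptional null set depends on [k]; a countable union makes one [t] serve for all members of
   the sequence. *)
have A1 := ae_foralln (fun k => wderiv_rep j (Wk k) n3).
have A2 := wderiv_rep j Wu n3.
apply: (aeS (aeI A1 A2)) => t [{}A1 {}A2] Dt.
rewrite A2//; under eq_fun do rewrite (A1 _ Dt).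
have [M MP] := @derive1_ramp_bounded R 2^-1 4^-1.
apply: cvgB.
- apply: (@weakly_converges_pairing _ _ _ _ _ M) => //.
  by apply: measurable_funS (measurable_derive1_ramp _ _).
- apply: (@weakly_converges_pairing _ _ _ _ _ 1) => //.
    by apply: measurable_funS (measurable_rep_kernel _).
  by move=> x _; exact: rep_kernel_le1.
Qed.

End Sobolev3.

(** * Uniform boundedness in L^1 *)

Section UniformBoundedness.
Context d (T : measurableType d) (R : realType) (mu : {measure set T -> \bar R}).
Variables (D : set T) (mD : measurable D) (c : nat -> T -> R).
Hypothesis ci : forall k, mu.-integrable D (EFin \o c k).

Let N k := \int[mu]_(x in D) `|c k x|.

Variable kap : nat -> nat.

(** With ratio 1/3, all steps after the one of size [pw n] add up to [3 / 2 * pw n.+1], which is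
    half of [pw n]. What step [n] gains is therefore never lost entirely. *)
Let pw n : R := (3^-1) ^+ n.

Let pw_gt0 n : 0 < pw n. Proof. by rewrite exprn_gt0// invr_gt0. Qed.

Let pwS n : pw n.+1 = pw n / 3. Proof. by rewrite /pw exprSr. Qed.

(* Sokal's gliding hump: a sign is added to or subtracted from the current
   function, whichever makes the pairing with [c (kap n)] large. *)
Fixpoint hump n : T -> R :=
  if n is m.+1 then
    let up x := hump m x + pw m * Num.sg (c (kap m) x) in
    let dn x := hump m x - pw m * Num.sg (c (kap m) x) in
    if pw m * N (kap m) <= `|\int[mu]_(x in D) (c (kap m) x * up x)| then up else dn
  else cst 0.

Let hump_cases n : hump n.+1 = (fun x => hump n x + pw n * Num.sg (c (kap n) x))
  \/ hump n.+1 = (fun x => hump n x - pw n * Num.sg (c (kap n) x)).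
Proof. by rewrite /=; case: ifP => _; [left|right]. Qed.

Let measurable_sg k : measurable_fun D (fun x => Num.sg (c k x)).
Proof.
have mc : measurable_fun D (c k) by move/integrableP: (ci k) => [/measurable_EFinP].
have -> : (fun x => Num.sg (c k x)) = (fun x => \1_[set y : R | 0 < y] (c k x) - \1_[set y : R| y < 0] (c k x)).
  apply/funext => x; rewrite !indicE; case: (ltgtP (c k x) 0) => h.
  - by rewrite ltr0_sg// memNset ?mem_set//= ?sub0r//; apply/negP; rewrite -leNgt ltW.
  - by rewrite gtr0_sg// mem_set// memNset ?subr0//=; apply/negP; rewrite -leNgt ltW.
  - by rewrite h sgr0 !memNset ?subrr//= ltxx.
apply: measurable_funB.
  apply: (measurableT_comp _ mc); apply: measurable_indic.
  have -> : [set y : R | 0 < y] = `]0, +oo[%classic by apply/seteqP; split => y /=; rewrite in_itv/= andbT.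
  exact: measurable_itv.
apply: (measurableT_comp _ mc); apply: measurable_indic.
have -> : [set y : R | y < 0] = `]-oo, 0[%classic by apply/seteqP; split => y /=; rewrite in_itv/=.
exact: measurable_itv.
Qed.

Let measurable_hump n : measurable_fun D (hump n).
Proof.
elim: n => [|n IH]; first exact: measurable_cst.
have mp : measurable_fun D (fun x => pw n * Num.sg (c (kap n) x)).
  by apply: measurable_funM => //; exact: measurable_sg.
by have [->|->] := hump_cases n; [exact: measurable_funD|exact: measurable_funB].
Qed.

Let sg_le1 (y : R) : `|Num.sg y| <= 1.
Proof. by rewrite normr_sg; case: (y != 0). Qed.

Let hump_step n x : `|hump n.+1 x - hump n x| <= pw n.
Proof.
have h : `|pw n * Num.sg (c (kap n) x)| <= pw n.
  by rewrite normrM gtr0_norm// ler_piMr// ltW.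
have [->|->] := hump_cases n; first by rewrite addrC addKr.
by rewrite addrC addKr normrN.
Qed.

Let hump_le n x : `|hump n x| <= 3 / 2.
Proof.
suff : `|hump n x| <= 3 / 2 - 3 / 2 * pw n by have := pw_gt0 n; lra.
elim: n => [|n IH]; first by rewrite normr0 /pw expr0; lra.
have := hump_step n x; have := ler_normD (hump n x) (hump n.+1 x - hump n x).
by rewrite subrKC pwS; lra.
Qed.

(** Let [A] be the pairing with [hump n] and [B = pw n * N (kap n)], which is the pairing with the
    added sign since [y * sg y = |y|]. If [|A + B| < B], then [A] is negative and [|A - B| >= B]. *)
Let hump_pairing n :
  pw n * N (kap n) <= `|\int[mu]_(x in D) (c (kap n) x * hump n.+1 x)|.
Proof.
rewrite /=; case: ifPn => //; rewrite -ltNge => up.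
have ms := @measurable_sg (kap n).
have i1 : mu.-integrable D (EFin \o (fun x => c (kap n) x * hump n x)).
  exact: integrable_mulr_bounded (ci _) (measurable_hump n) (fun x _ => hump_le n x).
have i2 : mu.-integrable D (EFin \o (fun x => pw n * `|c (kap n) x|)).
  rewrite (_ : EFin \o _ = (fun x => (pw n)%:E * (EFin \o (fun x => `|c (kap n) x|%R)) x)%E)//.
  by apply: integrableZl => //; exact: integrable_norm.
have e1 x : c (kap n) x * (pw n * Num.sg (c (kap n) x)) = pw n * `|c (kap n) x|.
  by rewrite mulrCA [_ * Num.sg _]mulrC -normrEsg.
have eN : \int[mu]_(x in D) (pw n * `|c (kap n) x|) = pw n * N (kap n).
  by rewrite RintegralZl//; exact: integrable_norm.
have := up.
under eq_Rintegral do rewrite mulrDr e1.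
under [X in _ -> _ <= `|X|]eq_Rintegral do rewrite mulrBr e1.
rewrite RintegralD// RintegralB// eN.
have : 0 <= pw n * N (kap n).
  by apply: mulr_ge0; [exact: ltW|exact: Rintegral_ge0].
move: (Rintegral _ _ _) (pw n * _) => A B B0; rewrite ltr_norml => /andP[h1 h2].
by rewrite ler0_norm; lra.
Qed.

(** Shifting by the sum of the remaining steps makes the humps monotone from below and from above.
    The limit then exists by monotone convergence and comes with the error bound [3 / 2 * pw n]. *)
Let lo n x := hump n x - 3 / 2 * pw n.
Let hi n x := hump n x + 3 / 2 * pw n.

Let lo_nd x : nondecreasing_seq (lo ^~ x).
Proof.
apply/nondecreasing_seqP => n; rewrite /lo pwS.
by have := hump_step n x; rewrite ler_norml => /andP[h _]; lra.
Qed.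

Let hi_ni x : nonincreasing_seq (hi ^~ x).
Proof.
apply/nonincreasing_seqP => n; rewrite /hi pwS.
by have := hump_step n x; rewrite ler_norml => /andP[_ h]; lra.
Qed.

Let lo_hi n m x : lo n x <= hi m x.
Proof.
apply: (@le_trans _ _ (lo (maxn n m) x)); first by apply: lo_nd; exact: leq_maxl.
apply: (@le_trans _ _ (hi (maxn n m) x)); last by apply: hi_ni; exact: leq_maxr.
by rewrite /lo /hi; have := pw_gt0 (maxn n m); lra.
Qed.

Definition hump_lim x := limn (lo ^~ x).

Let lo_cvg x : cvgn (lo ^~ x).
Proof.
apply: nondecreasing_is_cvgn => //; exists (hi 0 x) => _ [n _ <-].
exact: lo_hi.
Qed.

Let hump_limE n x : `|hump_lim x - hump n x| <= 3 / 2 * pw n.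
Proof.
have h1 : lo n x <= hump_lim x by apply: nondecreasing_cvgn_le.
have h2 : hump_lim x <= hi n x.
  by apply: limr_le => //; apply: nearW => m; exact: lo_hi.
by rewrite ler_norml; apply/andP; split; rewrite /lo /hi in h1 h2; lra.
Qed.

Lemma hump_lim_le x : `|hump_lim x| <= 3 / 2.
Proof. by have := hump_limE 0 x; rewrite /= subr0 /pw expr0; lra. Qed.

Lemma measurable_hump_lim : measurable_fun D hump_lim.
Proof.
apply: (@measurable_fun_cvg _ _ _ _ lo) => [n|x Dx]; last exact: lo_cvg.
by apply: measurable_funB => //; exact: measurable_hump.
Qed.

(** Replacing [hump n.+1] by the limit costs at most [3 / 2 * pw n.+1 * N (kap n)], half of the
    lower bound in [hump_pairing]. *)
Lemma hump_lim_pairing n : pw n * N (kap n) / 2 <= `|\int[mu]_(x in D) (c (kap n) x * hump_lim x)|.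
Proof.
have mh := measurable_hump n.+1.
have ml := measurable_hump_lim.
have i1 : mu.-integrable D (EFin \o (fun x => c (kap n) x * hump n.+1 x)).
  exact: integrable_mulr_bounded (ci _) mh (fun x _ => hump_le n.+1 x).
have i2 : mu.-integrable D (EFin \o (fun x => c (kap n) x * (hump_lim x - hump n.+1 x))).
  apply: (integrable_mulr_bounded mD (ci _)); first exact: measurable_funB.
  by move=> x _; exact: hump_limE.
have e : \int[mu]_(x in D) (c (kap n) x * hump_lim x) =
    \int[mu]_(x in D) (c (kap n) x * hump n.+1 x) +
    \int[mu]_(x in D) (c (kap n) x * (hump_lim x - hump n.+1 x)).
  by rewrite -RintegralD//; apply: eq_Rintegral => x _; rewrite -mulrDr subrKC.
have h1 := hump_pairing n.
have h2 : `|\int[mu]_(x in D) (c (kap n) x * (hump_lim x - hump n.+1 x))|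
    <= 3 / 2 * pw n.+1 * N (kap n).
  apply: (normr_Rintegral_mulr_le mD (ci _)); first exact: measurable_funB.
  by move=> x _; exact: hump_limE.
rewrite e; rewrite pwS in h2.
move: (Rintegral _ _ _) (Rintegral _ _ _) h1 h2 => A B h1 h2.
have := ler_normB (B + A) A; rewrite addrK.
by rewrite (_ : 3 / 2 * (pw n / 3) * N (kap n) = pw n * N (kap n) / 2) in h2; [lra|field].
Qed.

End UniformBoundedness.

(** Banach-Steinhaus for the functionals that the [c k] induce on bounded measurable functions. If
    their L^1 norms were unbounded, the limit of the humps would be a single function, bounded by
    [3 / 2], with unbounded pairings. *)
Lemma L1_uniform_boundedness d (T : measurableType d) (R : realType)
    (mu : {measure set T -> \bar R}) (D : set T) (c : nat -> T -> R) :
  measurable D -> (forall k, mu.-integrable D (EFin \o c k)) ->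
  (forall psi : T -> R, measurable_fun D psi -> (forall x, `|psi x| <= 2) ->
     exists M : R, forall k, `|\int[mu]_(x in D) (c k x * psi x)| <= M) ->
  exists K, forall k, \int[mu]_(x in D) `|c k x| <= K.
Proof.
move=> mD ci cb; apply: contrapT => /forallNP unb.
(* The factor [2 * 3 ^+ n] cancels the loss [pw n / 2] in [hump_lim_pairing], so that the pairing at
   step [n] exceeds [n]. *)
have /choice[kap kapP] : forall n : nat, exists k, 2 * 3 ^+ n * n%:R < \int[mu]_(x in D) `|c k x|.
  move=> n; have /existsNP[k /negP] := unb (2 * 3 ^+ n * n%:R).
  by rewrite -ltNge => h; exists k.
have h2 x : `|hump_lim mu D c kap x| <= 2 by have := hump_lim_le mu D c kap x; lra.
have [M MP] := cb _ (measurable_hump_lim ci kap) h2.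
pose n := (Num.truncn `|M|).+1.
have nM : M < n%:R by rewrite (le_lt_trans (ler_norm _))// truncnS_gt.
have := hump_lim_pairing mD ci kap n.
have := MP (kap n); have := kapP n.
move: (Rintegral _ _ _) (`|_|) => I J h1 h3 h4.
have p3 : 0 < 3 ^+ n :> R by rewrite exprn_gt0.
have : n%:R < (3^-1) ^+ n * I / 2.
  rewrite exprVn -mulrA mulrC -ltr_pdivrMr ?invr_gt0// invrK.
  by rewrite ltr_pdivlMr//; lra.
lra.
Qed.

(** * Lower semicontinuity of integrals with affine minorants *)

Lemma limn_einf_ge (R : realType) (x : nat -> \bar R) (r_ : nat -> R) (r : R) :
  r_ k @[k --> \oo] --> r -> (\forall k \near \oo, ((r_ k)%:E <= x k)%E) ->
  (r%:E <= limn_einf x)%E.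
Proof.
move=> rr rx; apply/lee_addgt0Pr => e e0.
rewrite -leeBlDr// -EFinB limn_einf_lim.
have [N _ NP] : \forall k \near \oo, ((r - e)%:E <= x k)%E.
  near=> k; apply: (@le_trans _ _ (r_ k)%:E); last by near: k.
  rewrite lee_fin lerBlDl -lerBlDr; near: k.
  have /cvgrPdist_le/(_ e e0) := rr; apply: filterS => k h.
  exact: le_trans (ler_norm _) h.
apply: lime_ge; first exact: is_cvg_einfs.
exists N => // n Nn; apply: le_ereal_inf_tmp => _ [k /= nk <-].
by apply: NP; exact: leq_trans Nn nk.
Unshelve. all: by end_near. Qed.

Lemma cvg_sum_finType (R : realType) (I : finType) (f : nat -> I -> R) (l : I -> R) :
  (forall i, f k i @[k --> \oo] --> l i) -> \sum_i f k i @[k --> \oo] --> \sum_i l i.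
Proof.
move=> fl; elim: (index_enum I) => [|i s IH].
  by rewrite big_nil; under eq_fun do rewrite big_nil; exact: cvg_cst.
by rewrite big_cons; under eq_fun do rewrite big_cons; exact: cvgD.
Qed.

Section LowerSemicontinuity.
Context d (T : measurableType d) (R : realType) (mu : {measure set T -> \bar R}).
Variables (D : set T) (mD : measurable D) (finD : (mu D < +oo)%E).

Lemma egorov0 (f : nat -> T -> R) (e : R) : (forall k, measurable_fun D (f k)) ->
  (\forall t \ae mu, D t -> f k t @[k --> \oo] --> 0) -> 0 < e ->
  exists B, [/\ measurable B, (mu B < e%:E)%E &
    forall delta, 0 < delta ->
      \forall k \near \oo, forall t, (D `\` B) t -> `|f k t| < delta].
Proof.
move=> mf f0 e0.
have [B [mB Be uB]] := @ae_pointwise_almost_uniform _ _ _ mu f (cst 0) D e mf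
  (measurable_cst _) mD finD f0 e0.
exists B; split => // delta delta0.
have : nbhs (cst 0 : {uniform` (D `\` B) -> R}) [set h | forall t, (D `\` B) t -> `|h t| < delta].
  apply/uniform_nbhs; exists [set xy : R * R | ball xy.1 delta xy.2]; split.
    exact: (entourage_ball _ (PosNum delta0)).
  by move=> h hB t Bt; have := hB _ Bt; rewrite /ball/= sub0r normrN.
by move/uB.
Qed.

(** Here [c_] converges weakly, [W_] converges almost everywhere, and [beta] comes from the limit
    and is only measurable. The minorant of [F_] in [F_ge] becomes an equality at the limit in
    [FE]. *)
Variables (I : finType) (W_ c_ : nat -> I -> T -> R) (W c beta : I -> T -> R).
Variables (F_ : nat -> T -> R) (F : T -> R).
Hypotheses (mW_ : forall k i, measurable_fun D (W_ k i))
  (mW : forall i, measurable_fun D (W i))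
  (mbeta : forall i, measurable_fun D (beta i))
  (mF_ : forall k, measurable_fun D (F_ k)) (mF : measurable_fun D F).
Hypotheses (ic_ : forall k i, mu.-integrable D (EFin \o c_ k i))
  (ic : forall i, mu.-integrable D (EFin \o c i)).
Hypotheses (F_0 : forall k t, D t -> 0 <= F_ k t) (F0 : forall t, D t -> 0 <= F t).
Hypothesis WW : forall i, \forall t \ae mu, D t -> W_ k i t @[k --> \oo] --> W i t.
Hypothesis cc : forall i (psi : T -> R) (M : R), measurable_fun D psi ->
  (forall t, D t -> `|psi t| <= M) ->
  \int[mu]_(t in D) (c_ k i t * psi t) @[k --> \oo] --> \int[mu]_(t in D) (c i t * psi t).
Hypothesis F_ge : forall k t, D t -> \sum_i c_ k i t * (beta i t * W_ k i t) <= F_ k t.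
Hypothesis FE : forall t, D t -> F t = \sum_i c i t * (beta i t * W i t).

(** Cutting off where this exceeds [m] turns [beta i * W i] into a bounded function, against which
    weak convergence may be tested, and also bounds [F]. *)
Let size t := \sum_i (`|beta i t| + `|W i t| + `|c i t|).
Let S (m : nat) := D `&` [set t | size t <= m%:R].

Let msize : measurable_fun D size.
Proof.
apply: measurable_sum => i; apply: measurable_funD; first apply: measurable_funD.
- exact: measurableT_comp.
- exact: measurableT_comp.
- by apply: measurableT_comp => //; have /integrableP[/measurable_EFinP] := ic i.
Qed.

Let mS m : measurable (S m).
Proof.
rewrite /S (_ : [set t | _] = size @^-1` `]-oo, m%:R]).
  by apply: msize => //; exact: measurable_itv.
by apply/seteqP; split => t /=; rewrite in_itv.
Qed.

Let size_le i t : [/\ `|beta i t| <= size t, `|W i t| <= size t & `|c i t| <= size t].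
Proof.
have : `|beta i t| + `|W i t| + `|c i t| <= size t.
  by rewrite /size (bigD1 i)//= lerDl sumr_ge0// => j _; rewrite !addr_ge0.
have := normr_ge0 (beta i t); have := normr_ge0 (W i t); have := normr_ge0 (c i t).
by move=> *; split; lra.
Qed.

Let c_bounded i : exists B : R, forall k, \int[mu]_(t in D) `|c_ k i t| <= B.
Proof.
apply: L1_uniform_boundedness => // psi mpsi psi2.
have /cvg_seq_bounded[M [_ MP]] : cvgn (fun k => \int[mu]_(t in D) (c_ k i t * psi t)).
  by apply/cvg_ex; eexists; apply: (@cc i psi 2).
exists (`|M| + 1) => k; apply: MP => //.
by rewrite (le_lt_trans (ler_norm M))// ltrDl.
Qed.

Let distW k t := \sum_i `|W_ k i t - W i t|.

Let distW_cvg : \forall t \ae mu, D t -> distW k t @[k --> \oo] --> 0.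
Proof.
apply: (aeS (ae_forall_finType WW)) => t h Dt; rewrite /distW.
rewrite [X in _ --> X](_ : 0 = \sum_(i : I) 0); last by rewrite big1.
apply: cvg_sum_finType => i.
rewrite [X in _ --> X](_ : 0 = `|W i t - W i t|); last by rewrite subrr normr0.
apply: cvg_norm; apply: cvgB; last exact: cvg_cst.
exact: h.
Qed.

(** In [c_k b W_k = c_k b (W_k - W) + c_k b W] the first term tends to 0 in the mean, by the L^1
    bound on [c_k] and uniform convergence on [E]; the second converges weakly. The factor [b],
    which is [beta] cut off outside [E], keeps all integrals over [D], and [F_k >= 0] covers the
    complement of [E]. *)
Let core m (E : set T) : measurable E -> E `<=` S m ->
  (forall delta, 0 < delta -> \forall k \near \oo, forall t, E t -> distW k t < delta) ->
  (\int[mu]_(t in E) (F t)%:E <= limn_einf (fun k => \int[mu]_(t in D) (F_ k t)%:E))%E.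
Proof.
move=> mE ES uE.
have ED : E `<=` D by move=> t /ES[].
pose b i t := beta i t * \1_E t.
have mb i : measurable_fun D (b i).
  by apply: measurable_funM => //; exact: measurable_indic.
have Esize t : E t -> size t <= m%:R by move=> /ES[].
have bE i t : E t -> b i t = beta i t by move=> Et; rewrite /b indicE mem_set// mulr1.
have bNE i t : ~ E t -> b i t = 0 by move=> Et; rewrite /b indicE memNset// mulr0.
have bW i t : D t -> `|b i t * W i t| <= m%:R * m%:R.
  move=> Dt; have [Et|Et] := pselect (E t); last by rewrite bNE// mul0r normr0.
  have [h1 h2 _] := size_le i t; have := Esize _ Et => h.
  by rewrite bE// normrM ler_pM// (le_trans _ h).
have bd k i delta t : (forall t, E t -> distW k t < delta) -> 0 < delta -> D t ->
    `|b i t * (W_ k i t - W i t)| <= m%:R * delta.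
  move=> h d0 Dt; have [Et|Et] := pselect (E t); last by rewrite bNE// mul0r normr0 mulr_ge0// ltW.
  have [h1 _ _] := size_le i t; have := Esize _ Et => h'.
  rewrite bE// normrM ler_pM//; first exact: le_trans h'.
  apply: le_trans (ltW (h _ Et)); rewrite /distW (bigD1 i)//= lerDl.
  by rewrite sumr_ge0.
have mbd k i : measurable_fun D (fun t => b i t * (W_ k i t - W i t)).
  by apply: measurable_funM => //; exact: measurable_funB.
have mbW i : measurable_fun D (fun t => b i t * W i t) by exact: measurable_funM.
have mbW_ k i : measurable_fun D (fun t => b i t * W_ k i t) by exact: measurable_funM.
pose r_ k := \sum_i \int[mu]_(t in D) (c_ k i t * (b i t * W_ k i t)).
pose r := \sum_i \int[mu]_(t in D) (c i t * (b i t * W i t)).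
have rE : (\int[mu]_(t in E) (F t)%:E = r%:E)%E.
  have ii i : mu.-integrable D (EFin \o (fun t => c i t * (b i t * W i t))).
    exact: integrable_mulr_bounded (ic i) (mbW i) (bW i).
  have isum : mu.-integrable D (EFin \o (fun t => \sum_i c i t * (b i t * W i t))).
    have -> : EFin \o (fun t => \sum_i c i t * (b i t * W i t)) =
        (fun t => \sum_(i <- index_enum I) (EFin \o (fun t => c i t * (b i t * W i t))%R) t)%E.
      by apply/funext => t /=; rewrite sumEFin.
    exact: integrable_sum.
  rewrite /r (_ : \sum_i _ = \int[mu]_(t in D) (\sum_i c i t * (b i t * W i t))).
    rewrite /Rintegral fineK; last exact: integrable_fin_num isum.
    rewrite -(setIidr ED) integral_mkcondr; apply: eq_integral => t; rewrite inE => Dt.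
    rewrite patchE; case: ifPn => [|].
      by rewrite inE => Et; rewrite FE//; congr EFin; apply: eq_bigr => i _; rewrite bE.
    by rewrite notin_setE => Et; rewrite big1// => i _; rewrite bNE// mul0r mulr0.
  apply/EFin_inj; rewrite /Rintegral fineK; last exact: integrable_fin_num isum.
  under [RHS]eq_integral do rewrite -sumEFin.
  rewrite integral_sum// -sumEFin; apply: eq_bigr => i _.
  by rewrite fineK//; exact: integrable_fin_num (ii i).
rewrite rE.
(* Only uniform closeness to [W] bounds [W_k] on [E], so the products are known to be integrable for
   large [k] only. *)
have near1 : \forall k \near \oo, forall t, E t -> distW k t < 1 by exact: uE.
have i1 k i : (forall t, E t -> distW k t < 1) ->
    mu.-integrable D (EFin \o (fun t => c_ k i t * (b i t * (W_ k i t - W i t)))).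
  move=> h; apply: (@integrable_mulr_bounded _ _ _ mu D mD _ _ (m%:R * 1)) => // t Dt.
  exact: bd.
have i2 k i : mu.-integrable D (EFin \o (fun t => c_ k i t * (b i t * W i t))).
  exact: integrable_mulr_bounded (ic_ k i) (mbW i) (bW i).
have split_ k i : (forall t, E t -> distW k t < 1) ->
    \int[mu]_(t in D) (c_ k i t * (b i t * W_ k i t)) =
    \int[mu]_(t in D) (c_ k i t * (b i t * (W_ k i t - W i t))) +
    \int[mu]_(t in D) (c_ k i t * (b i t * W i t)).
  move=> h; rewrite -RintegralD//; last exact: i1.
  by apply: eq_Rintegral => t _; ring.
have rr : r_ k @[k --> \oo] --> r.
  apply: cvg_sum_finType => i.
  have [B BP] := c_bounded i.
  have B0 : 0 <= B by apply: le_trans (BP 0%N); apply: Rintegral_ge0.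
  have h0 : \int[mu]_(t in D) (c_ k i t * (b i t * (W_ k i t - W i t))) @[k --> \oo] --> 0.
    apply/cvgr0Pnorm_le => e e0.
    (* The added 1 covers the case where [m] or [B] is 0. *)
    pose delta := e / (m%:R * B + 1).
    have mB0 : 0 <= m%:R * B by rewrite mulr_ge0.
    have d0 : 0 < delta by rewrite divr_gt0// ltr_wpDl.
    have := uE _ d0; apply: filterS => k hk.
    have := normr_Rintegral_mulr_le mD (ic_ k i) (mbd k i) (fun t Dt => bd k i _ t hk d0 Dt).
    move=> /le_trans; apply.
    apply: (@le_trans _ _ (m%:R * delta * B)).
      by rewrite ler_wpM2l// mulr_ge0// ltW.
    rewrite mulrAC /delta mulrA ler_pdivrMr ?ltr_wpDl// mulrC.
    by rewrite ler_wpM2l ?lerDl// ltW.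
  rewrite -[X in _ --> X]add0r.
  have h3 : \int[mu]_(t in D) (c_ k i t * (b i t * W i t)) @[k --> \oo] -->
      \int[mu]_(t in D) (c i t * (b i t * W i t)) by exact: cc (mbW i) (bW i).
  apply: cvg_trans (cvgD h0 h3); apply: near_eq_cvg.
  by apply: filterS near1 => k hk; rewrite split_.
apply: (limn_einf_ge rr); apply: filterS near1 => k hk.
have ii i : mu.-integrable D (EFin \o (fun t => c_ k i t * (b i t * W_ k i t))).
  have -> : EFin \o (fun t => c_ k i t * (b i t * W_ k i t)) =
    ((EFin \o (fun t => c_ k i t * (b i t * (W_ k i t - W i t)))%R) \+
     (EFin \o (fun t => c_ k i t * (b i t * W i t))%R))%E.
    by apply/funext => t /=; rewrite -EFinD; congr EFin; ring.
  by apply: integrableD => //; exact: i1.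
have -> : ((r_ k)%:E = \int[mu]_(t in D) (\sum_i c_ k i t * (b i t * W_ k i t))%:E)%E.
  under [RHS]eq_integral do rewrite -sumEFin.
  rewrite integral_sum// /r_ -sumEFin; apply: eq_bigr => i _.
  by rewrite fineK//; exact: integrable_fin_num (ii i).
have isum : mu.-integrable D (EFin \o (fun t => \sum_i c_ k i t * (b i t * W_ k i t))).
  have -> : EFin \o (fun t => \sum_i c_ k i t * (b i t * W_ k i t)) =
      (fun t => \sum_(i <- index_enum I) (EFin \o (fun t => c_ k i t * (b i t * W_ k i t))%R) t)%E.
    by apply/funext => t /=; rewrite sumEFin.
  exact: integrable_sum.
have mFk : measurable_fun D (EFin \o F_ k) by exact/measurable_EFinP.
(* If the nonnegative [F_ k] is not integrable, its integral is infinite and the inequality is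
   trivial. *)
have [fi|] := boolP (mu.-integrable D (EFin \o F_ k)).
  apply: le_integral => // t; rewrite inE => Dt; rewrite lee_fin.
  have [Et|Et] := pselect (E t).
    by rewrite (eq_bigr (fun i => c_ k i t * (beta i t * W_ k i t))) ?F_ge// => i _; rewrite bE.
  by rewrite big1 ?F_0// => i _; rewrite bNE// mul0r mulr0.
move=> nfi; rewrite (_ : \int[mu]_(t in D) (F_ k t)%:E = +oo)%E ?leey//.
apply/eqP; rewrite -leye_eq leNgt; apply: contra nfi => foo.
apply/integrableP; split => //; apply: le_lt_trans foo.
rewrite le_eqVlt; apply/orP; left; apply/eqP; apply: eq_integral => t; rewrite inE => Dt /=.
by rewrite ger0_norm// F_0.
Qed.

(** For fixed [m], [core] applies off the exceptional set [B] of Egorov, and on [S m] within [B] the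
    bounded [F] contributes at most [e]. Since the [S m] exhaust [D], monotone convergence
    concludes. *)
Lemma lsc_integral :
  (\int[mu]_(t in D) (F t)%:E <= limn_einf (fun k => \int[mu]_(t in D) (F_ k t)%:E))%E.
Proof.
set L := limn_einf _.
have mFS m : measurable_fun (S m) (EFin \o F).
  by apply/measurable_EFinP; apply: measurable_funS mF => // t [].
have main m : (\int[mu]_(t in S m) (F t)%:E <= L)%E.
  (* Each summand of [F] has three factors, each at most [m] on [S m]. The measure allowed to [B] is
     chosen after [m], as it depends on this bound. *)
  pose C : R := \sum_(i : I) m%:R * (m%:R * m%:R).
  have C0 : 0 <= C by rewrite sumr_ge0// => i _; rewrite !mulr_ge0.
  have FC t : S m t -> F t <= C.
    move=> [Dt /= st]; rewrite FE//; apply: ler_sum => i _.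
    apply: (le_trans (ler_norm _)); rewrite !normrM.
    by have [h1 h2 h3] := size_le i t; rewrite !ler_pM ?mulr_ge0// (le_trans _ st).
  apply/lee_addgt0Pr => e e0.
  have e1 : 0 < e / (C + 1) by rewrite divr_gt0// ltr_wpDl.
  have mdist k : measurable_fun D (distW k).
    apply: measurable_sum => i; apply: measurableT_comp => //.
    exact: measurable_funB.
  have [B [mB Be uB]] := egorov0 mdist distW_cvg e1.
  have -> : S m = (S m `\` B) `|` (S m `&` B) by rewrite setUC setUIDK.
  have mSB : measurable (S m `\` B) by exact: measurableD.
  have mSB' : measurable (S m `&` B) by exact: measurableI.
  rewrite ge0_integral_setU//; last 3 first.
  - by rewrite setUC setUIDK.
  - by move=> t; rewrite setUC setUIDK => -[Dt _]; rewrite lee_fin F0.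
  - by apply/disj_set2P; apply/seteqP; split => // t [[_ nB] [_ /nB]].
  apply: leeD.
    apply: (@core m _ mSB (@subDsetl _ _ _)) => delta d0.
     have := uB _ d0; apply: filterS => k h t [[Dt st] Bt].
    by rewrite (le_lt_trans (ler_norm _))// h.
  apply: (@le_trans _ _ (\int[mu]_(t in S m `&` B) C%:E)%E).
    apply: ge0_le_integral => //.
    - by move=> t [[Dt _] _]; rewrite lee_fin F0.
    - by apply: measurable_funS (mFS m) => // t [].
    - by move=> t [St _]; rewrite lee_fin FC.
  rewrite integral_cst//.
  apply: (@le_trans _ _ (C%:E * (e / (C + 1))%:E)%E).
    rewrite lee_wpmul2l ?lee_fin//; apply: le_trans (ltW Be).
    by rewrite le_measure ?inE//; exact: subIsetr.
  rewrite -EFinM lee_fin mulrA ler_pdivrMr ?ltr_wpDl// mulrC.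
  by rewrite ler_wpM2l ?lerDl// ltW.
have ndS : nondecreasing_seq S.
  move=> m n mn; apply/subsetPset => t [Dt /= st]; split => //=.
  by rewrite (le_trans st)// ler_nat.
have SD : \bigcup_m S m = D.
  apply/seteqP; split => [t [m _ []]//|t Dt]; exists (Num.truncn (size t)).+1 => //.
  by split => //=; rewrite ltW// truncnS_gt.
have F0S m t : S m t -> (0 <= (EFin \o F) t)%E by move=> [Dt _]; rewrite lee_fin F0.
have := @ge0_nondecreasing_set_cvg_integral _ _ _ S (EFin \o F) mu ndS mS mFS F0S.
rewrite SD => h; rewrite -(cvg_lim _ h)//; apply: lime_le.
  by apply/cvg_ex; eexists; exact: h.
by apply: nearW => m; exact: main.
Qed.

End LowerSemicontinuity.

(** * The Sadowsky functional *)

Section VectorAlgebra.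
Context {R : realType}.
Implicit Types a b c : 'rV[R]_3.

Lemma dot_cross a b c : dot a (cross b c) = dot (cross a b) c.
Proof.
have [q1 q2 [i11 i12 i21 i22]] : [/\ (0 + 1 = 1 :> 'I_3), (0 + 2 = 2 :> 'I_3) &
   [/\ (1 + 1 = 2 :> 'I_3), (1 + 2 = 0 :> 'I_3), (2 + 1 = 0 :> 'I_3) & (2 + 2 = 1 :> 'I_3)]].
  by do !split; apply/val_inj.
have l0 : lift ord0 ord0 = 1 :> 'I_3 by apply/val_inj.
have l1 : lift ord0 (lift ord0 ord0) = 2 :> 'I_3 by apply/val_inj.
have l2 : ord0 = 0 :> 'I_3 by apply/val_inj.
rewrite !dotE !big_ord_recl !big_ord0 l1 l0 l2 !mxE q1 q2 i11 i12 i21 i22.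
by ring.
Qed.

Lemma enorm_ge0 a : 0 <= enorm a. Proof. exact: sqrtr_ge0. Qed.

Lemma enorm_eq0 a : enorm a = 0 -> a = 0.
Proof.
move=> a0; apply/rowP => j; rewrite mxE; apply/eqP; rewrite -normr_le0 -a0.
exact: normr_le_enorm.
Qed.

(* The tangent line at [y] of the convex function [x |-> (1 + x^2)^2]. *)
Lemma quartic_tangent (x y : R) :
  (1 + y ^+ 2) ^+ 2 - 4 * y ^+ 2 * (1 + y ^+ 2) + 4 * y * (1 + y ^+ 2) * x <= (1 + x ^+ 2) ^+ 2.
Proof.
rewrite -subr_ge0.
(* Tangency produces the double root [x = y]; the cofactor is visibly positive. *)
have -> : (1 + x ^+ 2) ^+ 2 - ((1 + y ^+ 2) ^+ 2 - 4 * y ^+ 2 * (1 + y ^+ 2) + 4 * y * (1 + y ^+ 2) * x)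
   = (x - y) ^+ 2 * (2 + (x + y) ^+ 2 + 2 * y ^+ 2) by ring.
apply: mulr_ge0; first exact: sqr_ge0.
by have := sqr_ge0 (x + y); have := sqr_ge0 y; lra.
Qed.

End VectorAlgebra.

(** * The affine minorant of the Sadowsky integrand *)

Section Integrand.
Context {R : realType}.
Local Notation curve := (R -> 'rV[R]_3).
Implicit Types (u : curve) (s : R).

Definition sadowsky_integrand u s : R :=
  curvature u s ^+ 2 * (1 + torsion_ratio u s ^+ 2) ^+ 2.

(* [\sum_i sad_deriv i * (sad_coef i * sad_weight i)] is the minorant of the
   integrand that is affine in the third derivative; index 0 stands for the term
   without third derivative. *)
Definition sad_deriv u (i : 'I_4) s : R :=
  if unlift ord0 i is Some j then wderiv 3 u s 0 j else 1.

Definition sad_weight u (i : 'I_4) s : R :=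
  if unlift ord0 i is Some j then
    cross (wderiv 1 u s) (wderiv 2 u s) 0 j * (curvature u s)^-1
  else curvature u s ^+ 2.

Definition sad_coef (eta : R) (i : 'I_4) : R :=
  if unlift ord0 i is Some _ then 4 * eta * (1 + eta ^+ 2)
  else (1 + eta ^+ 2) ^+ 2 - 4 * eta ^+ 2 * (1 + eta ^+ 2).

Lemma sad_sumE u (eta s : R) :
  \sum_i sad_deriv u i s * (sad_coef eta i * sad_weight u i s) =
  curvature u s ^+ 2 * ((1 + eta ^+ 2) ^+ 2 - 4 * eta ^+ 2 * (1 + eta ^+ 2)
    + 4 * eta * (1 + eta ^+ 2) * torsion_ratio u s).
Proof.
rewrite big_ord_recl {1}/sad_deriv {1}/sad_coef {1}/sad_weight unlift_none mul1r.
rewrite (eq_bigr (fun j => (4 * eta * (1 + eta ^+ 2) * (curvature u s)^-1) *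
    (cross (wderiv 1 u s) (wderiv 2 u s) 0 j * wderiv 3 u s 0 j))); last first.
  by move=> j _; rewrite /sad_deriv /sad_coef /sad_weight liftK; ring.
rewrite -mulr_sumr -dotE -dot_cross /torsion_ratio -/(curvature u s).
(* Where the curvature vanishes, both sides are 0 thanks to [0^-1 = 0]. The minorant is thus valid
   also at zeros of the second derivatives of the sequence. *)
have [->|k0] := eqVneq (curvature u s) 0; first by rewrite invr0 expr0n/=; ring.
by field.
Qed.

(** Meant for a member [u] of the sequence and the torsion ratio [eta] of the limit, hence the free
    [eta]. *)
Lemma sad_sum_le u (eta s : R) :
  \sum_i sad_deriv u i s * (sad_coef eta i * sad_weight u i s) <= sadowsky_integrand u s.
Proof. by rewrite sad_sumE ler_wpM2l ?sqr_ge0// quartic_tangent. Qed.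

Lemma sad_sum_torsion u s : sadowsky_integrand u s =
  \sum_i sad_deriv u i s * (sad_coef (torsion_ratio u s) i * sad_weight u i s).
Proof. by rewrite sad_sumE /sadowsky_integrand; ring. Qed.

Lemma sadowsky_integrand_ge0 u s : 0 <= sadowsky_integrand u s.
Proof. by rewrite mulr_ge0// sqr_ge0. Qed.

Local Notation mu := (@lebesgue_measure R).
Local Notation D := (@unit_itv R).
Variables (p : R) (p1 : 1 < p).
Local Notation W := (@sobolev R 3 p).

Let mD : @measurable _ (measurableTypeR R) D := measurable_unit_itv.

Lemma measurable_curvature u : W u -> measurable_fun D (curvature u).
Proof. by move=> Wu; apply: measurable_enorm => // j; exact: (measurable_wderiv _ Wu). Qed.

Lemma measurable_curvatureV u : W u -> measurable_fun D (fun s => (curvature u s)^-1).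
Proof.
(* The real power with exponent -1 is measurable and agrees with the inverse on nonnegative numbers,
   0 included. *)
move=> Wu; have -> : (fun s => (curvature u s)^-1) = (fun s => curvature u s `^ (-1)).
  by apply/funext => s; rewrite powR_inv1// enorm_ge0.
by apply: (measurableT_comp (measurable_powR _)); exact: measurable_curvature.
Qed.

Lemma measurable_cross (f g : curve) j :
  (forall j, measurable_fun D (fun s => f s 0 j)) ->
  (forall j, measurable_fun D (fun s => g s 0 j)) ->
  measurable_fun D (fun s => cross (f s) (g s) 0 j).
Proof.
move=> mf mg; under eq_fun do rewrite mxE.
by apply: measurable_funB; exact: measurable_funM.
Qed.

Lemma measurable_torsion_ratio u : W u -> measurable_fun D (torsion_ratio u).
Proof.
move=> Wu; rewrite /torsion_ratio.
have -> : (fun s => dot (wderiv 1 u s) (cross (wderiv 2 u s) (wderiv 3 u s)) / enorm (wderiv 2 u s) ^+ 3)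
  = (fun s => (\sum_i wderiv 1 u s 0 i * cross (wderiv 2 u s) (wderiv 3 u s) 0 i) *
       ((curvature u s)^-1 ^+ 3)).
  by apply/funext => s; rewrite dotE exprVn.
apply: measurable_funM; last first.
  by apply: measurable_funX; exact: measurable_curvatureV.
apply: measurable_sum => i; apply: measurable_funM; first exact: (measurable_wderiv _ Wu).
by apply: measurable_cross => j; exact: (measurable_wderiv _ Wu).
Qed.

Lemma measurable_sadowsky_integrand u : W u -> measurable_fun D (sadowsky_integrand u).
Proof.
move=> Wu; apply: measurable_funM.
  by apply: measurable_funX; exact: measurable_curvature.
apply: measurable_funX; apply: measurable_funD => //; apply: measurable_funX.
exact: measurable_torsion_ratio.
Qed.

Lemma measurable_sad_weight u i : W u -> measurable_fun D (sad_weight u i).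
Proof.
move=> Wu; rewrite /sad_weight; case: unlift => [j|].
  apply: measurable_funM; last exact: measurable_curvatureV.
  by apply: measurable_cross => k; exact: (measurable_wderiv _ Wu).
by apply: measurable_funX; exact: measurable_curvature.
Qed.

Lemma measurable_sad_coef u i : W u ->
  measurable_fun D (fun s => sad_coef (torsion_ratio u s) i).
Proof.
move=> Wu; have mt := measurable_torsion_ratio Wu.
have m1 : measurable_fun D (fun s => 1 + torsion_ratio u s ^+ 2).
  by apply: measurable_funD => //; exact: measurable_funX.
rewrite /sad_coef; case: unlift => [j|].
  by apply: measurable_funM => //; exact: measurable_funM.
apply: measurable_funB; first exact: measurable_funX.
by apply: measurable_funM => //; apply: measurable_funM => //; exact: measurable_funX.
Qed.

Lemma integrable_sad_deriv u i : W u -> mu.-integrable D (EFin \o sad_deriv u i).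
Proof.
move=> Wu; rewrite /sad_deriv; case: unlift => [j|]; first exact: (wderiv_integrable p1 _ Wu).
apply: measurable_bounded_integrable => //; first exact: lebesgue_measure_unit_itv_lty.
by apply: (@bounded_on _ _ _ _ _ 1) => x _; rewrite normr1.
Qed.

Lemma cvg_enorm (f : nat -> 'rV[R]_3) (l : 'rV[R]_3) :
  (forall j, f k 0 j @[k --> \oo] --> l 0 j) -> enorm (f k) @[k --> \oo] --> enorm l.
Proof.
move=> fl; rewrite /enorm dotE; under eq_fun do rewrite dotE.
have h : \sum_i f k 0 i * f k 0 i @[k --> \oo] --> \sum_i l 0 i * l 0 i.
  by apply: cvg_sum_finType => i; exact: cvgM.
exact: (cvg_comp _ _ h (@sqrt_continuous R _)).
Qed.

(** Divided by the curvature, the cross product depends on [u''] only through its direction, which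
    has no limit in general as [u''] tends to 0. This is where the null set hypothesis on the zeros
    of [u''] takes effect. *)
Lemma cvg_sad_weight (u_ : nat -> curve) u (s : R) i : wderiv 2 u s <> 0 ->
  (forall j, wderiv 1 (u_ k) s 0 j @[k --> \oo] --> wderiv 1 u s 0 j) ->
  (forall j, wderiv 2 (u_ k) s 0 j @[k --> \oo] --> wderiv 2 u s 0 j) ->
  sad_weight (u_ k) i s @[k --> \oo] --> sad_weight u i s.
Proof.
move=> u0 a b; have ck := cvg_enorm b.
rewrite /sad_weight; case: unlift => [j|]; last by rewrite !expr2; apply: cvgM.
rewrite mxE; under eq_fun do rewrite mxE; apply: cvgM.
  by apply: cvgB; apply: cvgM.
by apply: cvgV => //; apply/eqP => /enorm_eq0.
Qed.

Lemma seq_weakly_lsc_sadowsky u : W u ->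
  mu [set t : R | 0 <= t <= 1 /\ wderiv 2 u t = 0] = 0%E ->
  seq_weakly_lsc_at W (@sobolev_norm R 3 p) sadowsky u.
Proof.
move=> Wu u0 u_ Wk uu.
have nz : {ae mu, forall s, D s -> wderiv 2 u s <> 0}.
  (* Read as an outer measure, the value 0 makes the set negligible without a proof of its
     measurability. *)
  have /negligible_outer_measure : mu [set t : R | 0 <= t <= 1 /\ wderiv 2 u t = 0] = 0%E by [].
  apply: negligibleS => s /= /not_implyP[]; rewrite /unit_itv/= in_itv/= => /andP[s0 s1].
  by move=> /contrapT us; split => //; rewrite !ltW.
have ca n : (0 < n < 3)%N -> {ae mu, forall s, forall j, D s ->
    wderiv n (u_ k) s 0 j @[k --> \oo] --> wderiv n u s 0 j}.
  move=> n3; apply: (@ae_forall_finType _ _ _ mu) => j.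
  exact: (weakly_converges_wderiv_ae p1 j Wk Wu uu n3).
apply: (@lsc_integral _ _ R mu D mD lebesgue_measure_unit_itv_lty _
  (fun k => sad_weight (u_ k)) (fun k => sad_deriv (u_ k)) (sad_weight u) (sad_deriv u)
  (fun i s => sad_coef (torsion_ratio u s) i)
  (fun k => sadowsky_integrand (u_ k)) (sadowsky_integrand u)).
- by move=> k i; exact: measurable_sad_weight.
- by move=> i; exact: measurable_sad_weight.
- by move=> i; exact: measurable_sad_coef.
- by move=> k; exact: measurable_sadowsky_integrand.
- exact: measurable_sadowsky_integrand.
- by move=> k i; exact: integrable_sad_deriv.
- by move=> i; exact: integrable_sad_deriv.
- by move=> k s _; exact: sadowsky_integrand_ge0.
- by move=> s _; exact: sadowsky_integrand_ge0.
- move=> i; apply: (aeS (aeI nz (aeI (ca 1%N isT) (ca 2%N isT)))) => s [h0 [h1 h2]] Ds.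
  by apply: cvg_sad_weight; [exact: h0|move=> j; exact: h1|move=> j; exact: h2].
- move=> i psi M mpsi psiM; rewrite /sad_deriv; case: unlift => [j|]; last exact: cvg_cst.
  exact: (@weakly_converges_pairing _ p p1 u_ u 3 j psi M uu).
- by move=> k s _; exact: sad_sum_le.
- by move=> s _; exact: sad_sum_torsion.
Qed.

End Integrand.

Theorem lemma5p1 (R : realType) (p : R) (A B : 'rV[R]_3 * 'rV[R]_3)
    (hA : enorm A.2 = 1) (hB : enorm B.2 = 1) (hp : 1 < p)
    (u : R -> 'rV[R]_3) (hu : X_ p A B u)
    (hu0 : lebesgue_measure [set t : R | 0 <= t <= 1 /\ wderiv 2 u t = 0] = 0%E) :
  seq_weakly_lsc_at (sobolev 3 p) (sobolev_norm 3 p) sadowsky u.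
Proof. exact: (seq_weakly_lsc_sadowsky hp hu.1 hu0). Qed.
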